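(* Let $f,g\in\mathcal H_{(d)}$ be nonzero and $x,y\in\mathbb C^{n+1}$ be nonzero, with $\operatorname{rank}Df(x)|_{x^\perp}=n$, $u\le 1/20$ and $v\le 1/20$. Then $\operatorname{rank}Dg(y)|_{y^\perp}=n$ and \[(1-3.805u-v)\,\mu(g,y)\le\mu(f,x)\le(1+3.504u+v)\,\mu(g,y).\]
   Context: $n\ge2$, $(d)=(d_1,\dots,d_n)$, $D=\max_i d_i\ge2$. $\mathcal H_{(d)}$: systems of $n$ homogeneous polynomials in $n+1$ complex variables of degrees $d_i$, with the Bombieri–Weyl inner product $\langle f,g\rangle=\sum_i\sum_{|\alpha|=d_i}\frac{\alpha_0!\cdots\alpha_n!}{d_i!}f_{i,\alpha}\overline{g_{i,\alpha}}$ and its norm. $x^\perp$ is the Hermitian orthogonal complement of $x$; $Df(x)|_{x^\perp}$ the restriction of the derivative. $\mu(f,x)=\|f\|\,\|(Df(x)|_{x^\perp})^{-1}\mathrm{diag}(\sqrt{d_i}\|x\|^{d_i-1})\|$ (operator norm), $\infty$ if not invertible. $d_R(x,y)\in[0,\pi/2]$ with $\cos d_R(x,y)=|\langle x,y\rangle|/(\|x\|\|y\|)$. $u=\frac{D^{3/2}}{2}\mu(f,x)d_R(x,y)$, $v=D^{1/2}\mu(f,x)\,\big\|\frac{f}{\|f\|}-\frac{g}{\|g\|}\big\|$. *)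

(* Defs.v *)
From Stdlib Require Import Reals Ratan Lra List Arith ClassicalEpsilon.
Import ListNotations.
Open Scope R_scope.

Record C := mkC { re : R; im : R }.
Definition C0 : C := mkC 0 0.
Definition C1 : C := mkC 1 0.
Definition RtoC (r : R) : C := mkC r 0.
Definition Cadd (a b : C) : C := mkC (re a + re b) (im a + im b).
Definition Csub (a b : C) : C := mkC (re a - re b) (im a - im b).
Definition Cmul (a b : C) : C :=
  mkC (re a * re b - im a * im b) (re a * im b + im a * re b).
Definition Cconj (a : C) : C := mkC (re a) (- im a).
Definition Cnorm2 (a : C) : R := re a * re a + im a * im a.
Definition Cabs (a : C) : R := sqrt (Cnorm2 a).
Fixpoint Cpow (a : C) (k : nat) : C :=
  match k with O => C1 | S k' => Cmul a (Cpow a k') end.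

Fixpoint Csumn (m : nat) (g : nat -> C) : C :=
  match m with O => C0 | S m' => Cadd (Csumn m' g) (g m') end.
Fixpoint Rsumn (m : nat) (g : nat -> R) : R :=
  match m with O => 0 | S m' => Rsumn m' g + g m' end.
Definition Csuml {A} (l : list A) (g : A -> C) : C :=
  fold_right (fun a s => Cadd (g a) s) C0 l.
Definition Rsuml {A} (l : list A) (g : A -> R) : R :=
  fold_right (fun a s => g a + s) 0 l.

(* ---------- vectors of C^m : functions nat -> C, indices 0..m-1 ---------- *)
Definition vec := nat -> C.
Definition herm (m : nat) (x y : vec) : C := Csumn m (fun j => Cmul (x j) (Cconj (y j))).
Definition vnorm (m : nat) (x : vec) : R := sqrt (Rsumn m (fun j => Cnorm2 (x j))).
Definition vnonzero (m : nat) (x : vec) : Prop := exists j, (j < m)%nat /\ x j <> C0.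
Definition orth (m : nat) (z x : vec) : Prop := herm m z x = C0.

(* Riemannian (projective) distance: d_R in [0, pi/2], cos d_R = |<x,y>|/(|x||y|) *)
Definition dR (m : nat) (x y : vec) : R :=
  acos (Cabs (herm m x y) / (vnorm m x * vnorm m y)).

Fixpoint monos (m d : nat) : list (list nat) :=
  match m with
  | O => if Nat.eqb d 0 then [[]] else []
  | S m' => flat_map (fun a => map (cons a) (monos m' (d - a))) (seq 0 (S d))
  end.

(* a homogeneous polynomial: coefficient f_alpha for alpha in monos (n+1) d
   (values at other lists are irrelevant); a system: index i in 0..n-1 *)
Definition poly := list nat -> C.
Definition system := nat -> poly.

Fixpoint monev (al : list nat) (x : vec) (j : nat) : C :=
  match al with
  | [] => C1
  | a :: r => Cmul (Cpow (x j) a) (monev r x (S j))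
  end.
Fixpoint mondiff (al : list nat) (x : vec) (j k : nat) : C :=
  match al with
  | [] => C0
  | a :: r =>
      if Nat.eqb j k
      then Cmul (RtoC (INR a)) (Cmul (Cpow (x j) (a - 1)) (monev r x (S j)))
      else Cmul (Cpow (x j) a) (mondiff r x (S j) k)
  end.

Definition Dfz (n : nat) (d : nat -> nat) (f : system) (x z : vec) : vec :=
  fun i => Csuml (monos (S n) (d i))
    (fun al => Cmul (f i al) (Csumn (S n) (fun k => Cmul (mondiff al x 0 k) (z k)))).

(* Bombieri-Weyl norm: <f,f> = sum_i sum_|alpha|=d_i (alpha_0!...alpha_n!/d_i!) |f_{i,alpha}|^2 *)
Definition bw_weight (al : list nat) (di : nat) : R :=
  INR (fold_right (fun a p => (fact a * p)%nat) 1%nat al) / INR (fact di).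
Definition normH (n : nat) (d : nat -> nat) (f : system) : R :=
  sqrt (Rsumn n (fun i => Rsuml (monos (S n) (d i))
          (fun al => bw_weight al (d i) * Cnorm2 (f i al)))).
Definition snonzero (n : nat) (d : nat -> nat) (f : system) : Prop :=
  exists i al, (i < n)%nat /\ In al (monos (S n) (d i)) /\ f i al <> C0.
Definition normdiff (n : nat) (d : nat -> nat) (f g : system) : system :=
  fun i al => Csub (Cmul (RtoC (/ normH n d f)) (f i al))
                   (Cmul (RtoC (/ normH n d g)) (g i al)).

Fixpoint Dmax (n : nat) (d : nat -> nat) : nat :=
  match n with O => O | S n' => Nat.max (Dmax n' d) (d n') end.

Definition lin_indep (m k : nat) (vs : nat -> vec) : Prop :=
  forall c : nat -> C,
    (forall i, (i < m)%nat -> Csumn k (fun l => Cmul (c l) (vs l i)) = C0) ->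
    forall l, (l < k)%nat -> c l = C0.
Definition rank_ge (n : nat) (d : nat -> nat) (f : system) (x : vec) (k : nat) : Prop :=
  exists zs : nat -> vec,
    (forall l, (l < k)%nat -> orth (S n) (zs l) x) /\
    lin_indep n k (fun l => Dfz n d f x (zs l)).
Definition rank_eq (n : nat) (d : nat -> nat) (f : system) (x : vec) (r : nat) : Prop :=
  rank_ge n d f x r /\ ~ rank_ge n d f x (S r).

Definition Rlub (E : R -> Prop) : R := epsilon (inhabits 0) (fun m => is_lub E m).
(* operator norm of (Df(x)|_{x^perp})^{-1} diag(sqrt d_i |x|^(d_i-1)) : C^n -> x^perp,
   written via preimages: z in x^perp with Df(x) z = diag(...) w *)
Definition opnorm_inv (n : nat) (d : nat -> nat) (f : system) (x : vec) : R :=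
  Rlub (fun t => exists w z : vec,
          vnorm n w = 1 /\ orth (S n) z x /\
          (forall i, (i < n)%nat ->
             Dfz n d f x z i =
             Cmul (RtoC (sqrt (INR (d i)) * vnorm (S n) x ^ (d i - 1))) (w i)) /\
          t = vnorm (S n) z).
(* mu(f,x) (meaningful, i.e. finite, when rank Df(x)|_{x^perp} = n) *)
Definition mu (n : nat) (d : nat -> nat) (f : system) (x : vec) : R :=
  normH n d f * opnorm_inv n d f x.

(* Main.v *)
From Stdlib Require Import Reals Ratan Lra Lia Psatz List Arith Classical ClassicalEpsilon.
Require Import Defs.
Import ListNotations.
Open Scope R_scope.

(* Let f and g have norm 1 and let x, y be unit vectors, with phases chosen so that
   <x, y> = c = cos t is real and t = d_R(x, y).  In the Bombieri-Weyl inner product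
   the functional h |-> Dh(x) z on polynomials of degree d is represented by a vector,
   and these representatives satisfy
     <(x, z), (y, w)> = d (<z, w> <x, y>^(d-1) + (d-1) <z, y> <x, w> <x, y>^(d-2)),
   obtained by differentiating the multinomial identity for <x, y>^d once in x and once
   in y.  Taking z orthogonal to x and w its projection orthogonal to y, Cauchy-Schwarz
   gives |Df_i(x) z - Df_i(y) w|^2 <= d_i |f_i|^2 (3 d_i t^2) |z|^2 and
   |D(f_i - g_i)(y) w|^2 <= d_i |f_i - g_i|^2 |w|^2.  So the scaled derivatives of f at x
   and of g at y differ by at most (sqrt (3 D) t + |f - g|) |z|, while c |z| <= |w| <= |z|.
   Since mu(f, x) is the least K with |z| <= K |scaled derivative of f at x applied to z|,
   and mu >= 1, both inequalities follow. *)

(** Differentiating a sum over all monomials twice is avoided by working in a ring with two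
    nilpotents e and h: the multinomial theorem holds there for formal reasons, and its coefficient
    of e h is already the mixed derivative. Comparing x and y through the orthogonal projection
    involves only these two points, so no path from x to y and no differential inequality for mu is
    required; the price is the factor c, a second-order loss since 1 - c <= t^2 / 2. The value mu(g,
    y) is a supremum picked by [epsilon], about which nothing is known before the rank is. A lower
    bound for the scaled derivative of g, free of mu(g, y), therefore has to come before the rank
    claim. In both inequalities the error is multiplied by mu(f, x), never by mu(g, y), which is why
    u and v control it. Constants: as D >= 2, the quantity sqrt D * mu(f, x) * t is at most u, so
    the error is at most sqrt 3 * u + v, and the factor c costs about u / 40 more. The total,
    roughly 1.76 u + v, lies well inside 3.805 u + v and 3.504 u + v. *)

(** * Complex arithmetic *)

Lemma C_eq (a b : C) : re a = re b -> im a = im b -> a = b.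
Proof. destruct a, b; simpl; intros; subst; reflexivity. Qed.

Ltac C_solve := intros; apply C_eq; simpl; ring.

Definition Copp (a : C) : C := mkC (- re a) (- im a).

Lemma C_ring : ring_theory C0 C1 Cadd Cmul Csub Copp (@eq C).
Proof. split; C_solve. Qed.
Add Ring C_as_ring : C_ring.

Lemma Cnorm2_ge0 a : 0 <= Cnorm2 a.
Proof. unfold Cnorm2; nra. Qed.

Lemma Cnorm2_eq0 a : Cnorm2 a = 0 -> a = C0.
Proof. unfold Cnorm2; intros; apply C_eq; simpl; nra. Qed.

Lemma Cnorm2_C0 : Cnorm2 C0 = 0.
Proof. unfold Cnorm2; simpl; ring. Qed.

Lemma Cnorm2_neq0 a : a <> C0 -> 0 < Cnorm2 a.
Proof.
  intros H; destruct (Cnorm2_ge0 a) as [h|h]; auto.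
  exfalso; apply H, Cnorm2_eq0; auto.
Qed.

Lemma Cnorm2_mul a b : Cnorm2 (Cmul a b) = Cnorm2 a * Cnorm2 b.
Proof. unfold Cnorm2; simpl; ring. Qed.

Lemma Cnorm2_conj a : Cnorm2 (Cconj a) = Cnorm2 a.
Proof. unfold Cnorm2; simpl; ring. Qed.

Lemma Cnorm2_RtoC r : Cnorm2 (RtoC r) = r * r.
Proof. unfold Cnorm2; simpl; ring. Qed.

Lemma Cnorm2_pow a k : Cnorm2 (Cpow a k) = Cnorm2 a ^ k.
Proof.
  induction k; simpl; [unfold Cnorm2; simpl; ring | rewrite Cnorm2_mul, IHk; ring].
Qed.

Lemma Cmul_conj a : Cmul a (Cconj a) = RtoC (Cnorm2 a).
Proof. unfold Cnorm2; apply C_eq; simpl; ring. Qed.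

Lemma Cconj_mul a b : Cconj (Cmul a b) = Cmul (Cconj a) (Cconj b).
Proof. C_solve. Qed.

Lemma Cconj_add a b : Cconj (Cadd a b) = Cadd (Cconj a) (Cconj b).
Proof. C_solve. Qed.

Lemma RtoC_mul a b : RtoC (a * b) = Cmul (RtoC a) (RtoC b).
Proof. C_solve. Qed.

Lemma Cpow_RtoC r k : Cpow (RtoC r) k = RtoC (r ^ k).
Proof. induction k; simpl; [reflexivity | rewrite IHk, RtoC_mul; reflexivity]. Qed.

Lemma Cpow_mul a b k : Cpow (Cmul a b) k = Cmul (Cpow a k) (Cpow b k).
Proof. induction k; simpl; [ring | rewrite IHk; ring]. Qed.

Lemma Cpow_add a k k' : Cpow a (k + k') = Cmul (Cpow a k) (Cpow a k').
Proof. induction k; simpl; [ring | rewrite IHk; ring]. Qed.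

Definition Cinv (a : C) : C := mkC (re a / Cnorm2 a) (- im a / Cnorm2 a).

Lemma Cmul_inv a : a <> C0 -> Cmul a (Cinv a) = C1.
Proof.
  intros H; apply Cnorm2_neq0 in H; unfold Cnorm2 in *.
  apply C_eq; simpl; unfold Cnorm2; field; lra.
Qed.

Lemma Cmul_integral a b : Cmul a b = C0 -> a <> C0 -> b = C0.
Proof.
  intros H Ha.
  replace b with (Cmul (Cmul a b) (Cinv a)).
  - rewrite H; ring.
  - transitivity (Cmul b (Cmul a (Cinv a))); [ring | rewrite Cmul_inv by auto; ring].
Qed.

Lemma RtoC_neq0 r : r <> 0 -> RtoC r <> C0.
Proof. intros H E; apply H; exact (f_equal re E). Qed.

(** * Finite sums and the weighted Cauchy-Schwarz inequality *)

Lemma Csuml_ext {A} (l : list A) g h :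
  (forall a, In a l -> g a = h a) -> Csuml l g = Csuml l h.
Proof.
  induction l; simpl; intros H; auto. rewrite H, IHl by auto; auto.
Qed.

Lemma Rsuml_ext {A} (l : list A) g h :
  (forall a, In a l -> g a = h a) -> Rsuml l g = Rsuml l h.
Proof.
  induction l; simpl; intros H; auto. rewrite H, IHl by auto; auto.
Qed.

Lemma Csuml_add {A} (l : list A) g h :
  Csuml l (fun a => Cadd (g a) (h a)) = Cadd (Csuml l g) (Csuml l h).
Proof. induction l; simpl; [ring | rewrite IHl; ring]. Qed.

Lemma Csuml_scal {A} (l : list A) c g :
  Csuml l (fun a => Cmul c (g a)) = Cmul c (Csuml l g).
Proof. induction l; simpl; [ring | rewrite IHl; ring]. Qed.

Lemma Rsuml_scal {A} (l : list A) c g :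
  Rsuml l (fun a => c * g a) = c * Rsuml l g.
Proof. induction l; simpl; [ring | rewrite IHl; ring]. Qed.

Lemma Rsuml_add {A} (l : list A) g h :
  Rsuml l (fun a => g a + h a) = Rsuml l g + Rsuml l h.
Proof. induction l; simpl; [ring | rewrite IHl; ring]. Qed.

Lemma Rsuml_ge0 {A} (l : list A) g :
  (forall a, In a l -> 0 <= g a) -> 0 <= Rsuml l g.
Proof.
  induction l; simpl; intros H; [lra|].
  specialize (IHl (fun a h => H a (or_intror h))). specialize (H a (or_introl eq_refl)). lra.
Qed.

Lemma re_Csuml {A} (l : list A) g : re (Csuml l g) = Rsuml l (fun a => re (g a)).
Proof. induction l; simpl; auto; rewrite IHl; auto. Qed.

Lemma Cconj_Csuml {A} (l : list A) g : Cconj (Csuml l g) = Csuml l (fun a => Cconj (g a)).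
Proof. induction l; simpl; [C_solve | rewrite Cconj_add, IHl; auto]. Qed.

Lemma Csuml_app {A} (l1 l2 : list A) g :
  Csuml (l1 ++ l2) g = Cadd (Csuml l1 g) (Csuml l2 g).
Proof. induction l1; simpl; [ring | rewrite IHl1; ring]. Qed.

Lemma Rsuml_app {A} (l1 l2 : list A) g :
  Rsuml (l1 ++ l2) g = Rsuml l1 g + Rsuml l2 g.
Proof. induction l1; simpl; [ring | rewrite IHl1; ring]. Qed.

Lemma Csumn_seq m g : Csumn m g = Csuml (seq 0 m) g.
Proof.
  induction m; auto. rewrite seq_S, Csuml_app; simpl. rewrite IHm; ring.
Qed.

Lemma Rsumn_seq m g : Rsumn m g = Rsuml (seq 0 m) g.
Proof.
  induction m; auto. rewrite seq_S, Rsuml_app; simpl. rewrite IHm; ring.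
Qed.

Lemma Csumn_ext m g h : (forall k, (k < m)%nat -> g k = h k) -> Csumn m g = Csumn m h.
Proof. induction m; simpl; intros H; auto. rewrite H, IHm by auto; auto. Qed.

Lemma Rsumn_ext m g h : (forall k, (k < m)%nat -> g k = h k) -> Rsumn m g = Rsumn m h.
Proof. induction m; simpl; intros H; auto. rewrite H, IHm by auto; auto. Qed.

Lemma Csumn_add m g h : Csumn m (fun a => Cadd (g a) (h a)) = Cadd (Csumn m g) (Csumn m h).
Proof. induction m; simpl; [ring | rewrite IHm; ring]. Qed.

Lemma Csumn_scal m c g : Csumn m (fun a => Cmul c (g a)) = Cmul c (Csumn m g).
Proof. induction m; simpl; [ring | rewrite IHm; ring]. Qed.

Lemma Csumn_eq0 m g : (forall k, (k < m)%nat -> g k = C0) -> Csumn m g = C0.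
Proof. induction m; simpl; intros H; auto. rewrite H, IHm by auto; ring. Qed.

Lemma Rsumn_scal m c g : Rsumn m (fun a => c * g a) = c * Rsumn m g.
Proof. induction m; simpl; [ring | rewrite IHm; ring]. Qed.

Lemma Rsumn_le m g h : (forall k, (k < m)%nat -> g k <= h k) -> Rsumn m g <= Rsumn m h.
Proof.
  induction m; simpl; intros H; [lra|].
  specialize (IHm (fun k hk => H k (Nat.lt_lt_succ_r _ _ hk))).
  specialize (H m (Nat.lt_succ_diag_r m)). lra.
Qed.

Lemma Rsumn_ge0 m g : (forall k, (k < m)%nat -> 0 <= g k) -> 0 <= Rsumn m g.
Proof.
  induction m; simpl; intros H; [lra|].
  specialize (IHm (fun k hk => H k (Nat.lt_lt_succ_r _ _ hk))).
  specialize (H m (Nat.lt_succ_diag_r m)). lra.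
Qed.

Lemma Rsumn_ge_term m g p :
  (forall k, (k < m)%nat -> 0 <= g k) -> (p < m)%nat -> g p <= Rsumn m g.
Proof.
  induction m; simpl; intros H Hp; [lia|].
  pose proof (Rsumn_ge0 m g (fun k hk => H k (Nat.lt_lt_succ_r _ _ hk))).
  destruct (Nat.eq_dec p m); [subst; lra|].
  assert (Hp' : (p < m)%nat) by lia.
  specialize (IHm (fun k hk => H k (Nat.lt_lt_succ_r _ _ hk)) Hp').
  specialize (H m (Nat.lt_succ_diag_r m)). lra.
Qed.

(** Arithmetic-geometric mean without square roots, from (P + Q)^2 = (P - Q)^2 + 4 P Q. It controls
    the cross term in the Cauchy-Schwarz induction. *)
Lemma AMGM_sq P Q t : 0 <= P -> 0 <= Q -> t * t <= P * Q -> 2 * t <= P + Q.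
Proof.
  intros HP HQ H.
  pose proof (Rle_0_sqr (P - Q)) as Hs; unfold Rsqr in Hs.
  assert ((2 * t) * (2 * t) <= (P + Q) * (P + Q)) by lra.
  destruct (Rle_dec (2 * t) (P + Q)); auto. nra.
Qed.

(** The weights are dual: with [w] the Bombieri-Weyl weight, the first factor is the squared norm of
    a polynomial and the second that of the vector representing a functional on coefficients. *)
Lemma weighted_Cauchy_Schwarz {A} (l : list A) (a b : A -> C) (w : A -> R) :
  (forall k, In k l -> 0 < w k) ->
  Cnorm2 (Csuml l (fun k => Cmul (a k) (b k)))
  <= Rsuml l (fun k => w k * Cnorm2 (a k)) * Rsuml l (fun k => / w k * Cnorm2 (b k)).
Proof.
  induction l as [|k l IH]; simpl; intros Hw.
  - rewrite Cnorm2_C0; lra.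
  - specialize (IH (fun j h => Hw j (or_intror h))).
    assert (Hk := Hw k (or_introl eq_refl)).
    assert (HA : 0 <= Rsuml l (fun k => w k * Cnorm2 (a k))).
    { apply Rsuml_ge0; intros j hj. specialize (Hw j (or_intror hj)).
      pose proof (Cnorm2_ge0 (a j)); nra. }
    assert (HB : 0 <= Rsuml l (fun k => / w k * Cnorm2 (b k))).
    { apply Rsuml_ge0; intros j hj. specialize (Hw j (or_intror hj)).
      apply Rmult_le_pos; [left; apply Rinv_0_lt_compat; auto | apply Cnorm2_ge0]. }
    set (X := Rsuml l (fun k => w k * Cnorm2 (a k))) in *.
    set (Y := Rsuml l (fun k => / w k * Cnorm2 (b k))) in *.
    set (s := Csuml l (fun k => Cmul (a k) (b k))) in *.
    set (p := Cmul (a k) (b k)).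
    assert (Hp : Cnorm2 p = (w k * Cnorm2 (a k)) * (/ w k * Cnorm2 (b k))).
    { unfold p; rewrite Cnorm2_mul; field; lra. }
    pose proof (Cnorm2_ge0 (a k)); pose proof (Cnorm2_ge0 (b k)).
    assert (Hi : 0 < / w k) by (apply Rinv_0_lt_compat; auto).
    assert (P0 : 0 <= w k * Cnorm2 (a k)) by nra.
    assert (Q0 : 0 <= / w k * Cnorm2 (b k)) by nra.
    set (P := w k * Cnorm2 (a k)) in *. set (Q := / w k * Cnorm2 (b k)) in *.
    assert (Ht : 2 * (re s * re p + im s * im p) <= X * Q + Y * P).
    { apply AMGM_sq; try nra.
      apply Rle_trans with (Cnorm2 s * Cnorm2 p).
      (* Lagrange's identity: the difference of the two sides is the square of
         [re s * im p - im s * re p]. *)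
      - pose proof (Rle_0_sqr (re s * im p - im s * re p)) as Hs.
        unfold Rsqr in Hs; unfold Cnorm2; lra.
      - rewrite Hp. replace (X * Q * (Y * P)) with ((X * Y) * (P * Q)) by ring.
        apply Rmult_le_compat_r; nra. }
    replace (Cnorm2 (Cadd p s)) with (Cnorm2 s + Cnorm2 p + 2 * (re s * re p + im s * im p))
      by (unfold Cnorm2; simpl; ring).
    rewrite Hp; nra.
Qed.

(** * The Gram matrix of the derivative functionals *)

(* The ring C[e, h]/(e^2, h^2); [bd1], [bd2], [bd12] are the coefficients of e, h, e h. *)
Record bidual := mkB { bd0 : C; bd1 : C; bd2 : C; bd12 : C }.

Lemma bidual_eq a b :
  bd0 a = bd0 b -> bd1 a = bd1 b -> bd2 a = bd2 b -> bd12 a = bd12 b -> a = b.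
Proof. destruct a, b; simpl; intros; subst; reflexivity. Qed.

Definition B0 := mkB C0 C0 C0 C0.
Definition B1 := mkB C1 C0 C0 C0.
Definition Badd a b :=
  mkB (Cadd (bd0 a) (bd0 b)) (Cadd (bd1 a) (bd1 b))
      (Cadd (bd2 a) (bd2 b)) (Cadd (bd12 a) (bd12 b)).
Definition Bopp a := mkB (Copp (bd0 a)) (Copp (bd1 a)) (Copp (bd2 a)) (Copp (bd12 a)).
Definition Bsub a b := Badd a (Bopp b).
Definition Bmul a b :=
  mkB (Cmul (bd0 a) (bd0 b))
      (Cadd (Cmul (bd0 a) (bd1 b)) (Cmul (bd1 a) (bd0 b)))
      (Cadd (Cmul (bd0 a) (bd2 b)) (Cmul (bd2 a) (bd0 b)))
      (Cadd (Cadd (Cmul (bd0 a) (bd12 b)) (Cmul (bd12 a) (bd0 b)))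
            (Cadd (Cmul (bd1 a) (bd2 b)) (Cmul (bd2 a) (bd1 b)))).
Definition Breal (r : R) := mkB (RtoC r) C0 C0 C0.

Lemma bidual_ring : ring_theory B0 B1 Badd Bmul Bsub Bopp (@eq bidual).
Proof. split; intros; apply bidual_eq; simpl; ring. Qed.
Add Ring bidual_as_ring : bidual_ring.

Fixpoint Bpow (a : bidual) (k : nat) : bidual :=
  match k with O => B1 | S k' => Bmul a (Bpow a k') end.
Definition Bsuml {A} (l : list A) (g : A -> bidual) : bidual :=
  fold_right (fun a s => Badd (g a) s) B0 l.

Lemma Breal_mul a b : Breal (a * b) = Bmul (Breal a) (Breal b).
Proof. apply bidual_eq; simpl; [rewrite RtoC_mul| | |]; ring. Qed.

Lemma Breal_add a b : Breal (a + b) = Badd (Breal a) (Breal b).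
Proof. apply bidual_eq; simpl; [C_solve| | |]; ring. Qed.

Lemma Breal_1 : Breal 1 = B1.
Proof. reflexivity. Qed.

Lemma Bsuml_ext {A} (l : list A) g h :
  (forall a, In a l -> g a = h a) -> Bsuml l g = Bsuml l h.
Proof.
  induction l; simpl; intros H; auto. rewrite H, IHl by auto; auto.
Qed.

Lemma Bsuml_add {A} (l : list A) g h :
  Bsuml l (fun a => Badd (g a) (h a)) = Badd (Bsuml l g) (Bsuml l h).
Proof. induction l; simpl; [ring | rewrite IHl; ring]. Qed.

Lemma Bsuml_scal {A} (l : list A) c g :
  Bsuml l (fun a => Bmul c (g a)) = Bmul c (Bsuml l g).
Proof. induction l; simpl; [ring | rewrite IHl; ring]. Qed.

Lemma Bsuml_app {A} (l1 l2 : list A) g :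
  Bsuml (l1 ++ l2) g = Badd (Bsuml l1 g) (Bsuml l2 g).
Proof. induction l1; simpl; [ring | rewrite IHl1; ring]. Qed.

Lemma Bsuml_map {A A'} (l : list A) (k : A -> A') g :
  Bsuml (map k l) g = Bsuml l (fun a => g (k a)).
Proof. induction l; simpl; [auto | rewrite IHl; auto]. Qed.

Lemma Bsuml_flat_map {A A'} (l : list A) (k : A -> list A') g :
  Bsuml (flat_map k l) g = Bsuml l (fun a => Bsuml (k a) g).
Proof. induction l; simpl; [auto | rewrite Bsuml_app, IHl; auto]. Qed.

Lemma bd0_Bsuml {A} (l : list A) g : bd0 (Bsuml l g) = Csuml l (fun a => bd0 (g a)).
Proof. induction l; simpl; [auto | rewrite IHl; auto]. Qed.
Lemma bd1_Bsuml {A} (l : list A) g : bd1 (Bsuml l g) = Csuml l (fun a => bd1 (g a)).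
Proof. induction l; simpl; [auto | rewrite IHl; auto]. Qed.
Lemma bd2_Bsuml {A} (l : list A) g : bd2 (Bsuml l g) = Csuml l (fun a => bd2 (g a)).
Proof. induction l; simpl; [auto | rewrite IHl; auto]. Qed.
Lemma bd12_Bsuml {A} (l : list A) g : bd12 (Bsuml l g) = Csuml l (fun a => bd12 (g a)).
Proof. induction l; simpl; [auto | rewrite IHl; auto]. Qed.

(** * Divided powers and the multinomial theorem *)

Definition divpow (a : bidual) (k : nat) := Bmul (Breal (/ INR (fact k))) (Bpow a k).

Lemma divpow_S a k : Bmul (Breal (INR (S k))) (divpow a (S k)) = Bmul a (divpow a k).
Proof.
  unfold divpow; simpl Bpow.
  transitivity (Bmul (Breal (INR (S k) * / INR (fact (S k)))) (Bmul a (Bpow a k))).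
  - rewrite Breal_mul; ring.
  - replace (INR (S k) * / INR (fact (S k))) with (/ INR (fact k)); [ring|].
    rewrite fact_simpl, mult_INR. field.
    split; [apply INR_fact_neq_0 | apply not_0_INR; lia].
Qed.

(** The ring has zero divisors, but it contains the reals, so positive integers are units. *)
Lemma Bmul_nat_cancel k a b :
  Bmul (Breal (INR (S k))) a = Bmul (Breal (INR (S k))) b -> a = b.
Proof.
  intros H.
  assert (E : forall c, c = Bmul (Breal (/ INR (S k))) (Bmul (Breal (INR (S k))) c)).
  { intros c. transitivity (Bmul (Breal (/ INR (S k) * INR (S k))) c).
    - rewrite Rinv_l, Breal_1 by (apply not_0_INR; lia). ring.
    - rewrite Breal_mul; ring. }
  rewrite (E a), (E b), H; reflexivity.
Qed.

Lemma Bsuml_seq_first d u :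
  Bsuml (seq 0 (S d)) u = Badd (u 0%nat) (Bsuml (seq 0 d) (fun a => u (S a))).
Proof. simpl. rewrite <- seq_shift, Bsuml_map. reflexivity. Qed.

Lemma Bsuml_seq_last d u : Bsuml (seq 0 (S d)) u = Badd (Bsuml (seq 0 d) u) (u d).
Proof. rewrite seq_S, Bsuml_app; simpl. ring. Qed.

(** Divided powers a^k / k! remove the binomial coefficients, leaving a plain convolution. In the
    induction step, multiplying by d + 1 = a + (d + 1 - a) lets each half lower one divided power,
    which produces s times the previous sum plus p times the previous sum. *)
Lemma divpow_binomial s p d :
  Bsuml (seq 0 (S d)) (fun a => Bmul (divpow s a) (divpow p (d - a))) = divpow (Badd s p) d.
Proof.
  induction d as [|d IH].
  - simpl. unfold divpow; simpl. rewrite Rinv_1, Breal_1. ring.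
  - apply (Bmul_nat_cancel d). rewrite divpow_S, <- IH, <- Bsuml_scal.
    transitivity (Badd
      (Bsuml (seq 0 (S (S d))) (fun a =>
         Bmul (Bmul (Breal (INR a)) (divpow s a)) (divpow p (S d - a))))
      (Bsuml (seq 0 (S (S d))) (fun a =>
         Bmul (divpow s a) (Bmul (Breal (INR (S d - a))) (divpow p (S d - a)))))).
    + rewrite <- Bsuml_add. apply Bsuml_ext. intros a Ha. apply in_seq in Ha.
      replace (INR (S d)) with (INR a + INR (S d - a)).
      * rewrite Breal_add; ring.
      * rewrite <- plus_INR; f_equal; lia.
    (* The term [a = 0] of the first sum and the term [a = S d] of the second carry the factor
       [INR 0]; without them both sums have the length of the induction hypothesis. *)
    + rewrite (Bsuml_seq_first (S d)), (Bsuml_seq_last (S d)).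
      rewrite Nat.sub_diag. change (Breal (INR 0)) with B0.
      transitivity (Badd (Bmul s (divpow (Badd s p) d)) (Bmul p (divpow (Badd s p) d))).
      * rewrite <- IH, <- !Bsuml_scal.
        match goal with |- Badd (Badd ?z ?u) (Badd ?v ?t) = Badd ?u' ?v' =>
          replace u with u'; [replace v with v'; [ring|]|] end;
        apply Bsuml_ext; intros a Ha; apply in_seq in Ha.
        -- replace (S d - a)%nat with (S (d - a)) by lia. rewrite divpow_S; ring.
        -- rewrite divpow_S. simpl Nat.sub. ring.
      * rewrite IH; ring.
Qed.

Fixpoint Bmon (al : list nat) (X : nat -> bidual) (j : nat) : bidual :=
  match al with
  | [] => B1
  | a :: r => Bmul (Bpow (X j) a) (Bmon r X (S j))
  end.

Definition factl (al : list nat) : nat := fold_right (fun a p => (fact a * p)%nat) 1%nat al.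

Lemma INR_factl_pos al : 0 < INR (factl al).
Proof.
  apply lt_0_INR. induction al as [|a al IH]; simpl; [lia|].
  fold (factl al). pose proof (lt_O_fact a). nia.
Qed.

(** [monos] chooses the first exponent [a] and then the rest of degree [d - a], exactly the
    convolution of [divpow_binomial]. The offset [j] is general because the tail of [Bmon] starts at
    [S j]. *)
Lemma bidual_multinomial m d X j :
  Bsuml (monos m d) (fun al => Bmul (Breal (/ INR (factl al))) (Bmon al X j))
  = divpow (Bsuml (seq j m) X) d.
Proof.
  revert d j; induction m as [|m IH]; intros d j.
  - destruct d; simpl; unfold divpow; simpl.
    + rewrite Rinv_1, Breal_1; ring.
    + ring.
  - change (Bsuml (seq j (S m)) X) with (Badd (X j) (Bsuml (seq (S j) m) X)).
    rewrite <- divpow_binomial.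
    change (monos (S m) d) with (flat_map (fun a => map (cons a) (monos m (d - a))) (seq 0 (S d))).
    rewrite Bsuml_flat_map.
    apply Bsuml_ext; intros a Ha.
    rewrite Bsuml_map, <- (IH (d - a)%nat (S j)), <- Bsuml_scal.
    apply Bsuml_ext; intros b Hb. simpl. fold (factl b).
    rewrite mult_INR, Rinv_mult, Breal_mul. unfold divpow; ring.
Qed.

(** * Derivatives of monomials as nilpotent coefficients *)

Fixpoint mdir (al : list nat) (x z : vec) (j : nat) : C :=
  match al with
  | [] => C0
  | a :: r =>
      Cadd (Cmul (Cmul (Cmul (RtoC (INR a)) (Cpow (x j) (a - 1))) (monev r x (S j))) (z j))
           (Cmul (Cpow (x j) a) (mdir r x z (S j)))
  end.

(** Trades the partial derivatives of the definition of [Dfz] for the directional derivative [mdir],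
    which is what evaluating a monomial at x + e z produces. *)
Lemma sum_mondiff al x z j :
  Csuml (seq j (length al)) (fun k => Cmul (mondiff al x j k) (z k)) = mdir al x z j.
Proof.
  revert j; induction al as [|a r IH]; intros j; auto.
  cbn [length seq Csuml fold_right mdir mondiff]. rewrite Nat.eqb_refl.
  fold (@Csuml nat). rewrite <- IH, <- Csuml_scal. f_equal; [ring|].
  apply Csuml_ext; intros k Hk; apply in_seq in Hk.
  destruct (Nat.eqb_spec j k); [lia|]. ring.
Qed.

Lemma in_monos m d al : In al (monos m d) -> length al = m /\ fold_right Nat.add 0%nat al = d.
Proof.
  revert d al; induction m as [|m IH]; intros d al.
  - destruct d; simpl; [intros [<-|[]]; auto | tauto].
  - change (monos (S m) d) with (flat_map (fun a => map (cons a) (monos m (d - a))) (seq 0 (S d))).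
    rewrite in_flat_map. intros (a & Ha & H). apply in_seq in Ha.
    apply in_map_iff in H; destruct H as (b & <- & Hb).
    destruct (IH _ _ Hb). simpl; lia.
Qed.

Lemma Dfz_mdir n d f x z i :
  Dfz n d f x z i = Csuml (monos (S n) (d i)) (fun al => Cmul (f i al) (mdir al x z 0)).
Proof.
  apply Csuml_ext; intros al Hal. apply in_monos in Hal; destruct Hal as [Hl _].
  f_equal. rewrite <- sum_mondiff, Hl, Csumn_seq; reflexivity.
Qed.

Lemma Bpow_e a b k :
  Bpow (mkB a b C0 C0) k
  = mkB (Cpow a k) (Cmul (Cmul (RtoC (INR k)) (Cpow a (k - 1))) b) C0 C0.
Proof.
  induction k as [|k IH].
  - apply bidual_eq; simpl; try ring. change (RtoC 0) with C0; ring.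
  - cbn [Bpow]. rewrite IH. replace (S k - 1)%nat with k by lia.
    rewrite S_INR.
    replace (RtoC (INR k + 1)) with (Cadd (RtoC (INR k)) C1) by C_solve.
    apply bidual_eq; simpl; try ring.
    (* [k - 1] truncates at [k = 0], where the factor [INR k] vanishes anyway. *)
    destruct k; simpl; [change (RtoC 0) with C0; ring|]. rewrite Nat.sub_0_r. ring.
Qed.

Lemma Bpow_h a b k :
  Bpow (mkB a C0 b C0) k
  = mkB (Cpow a k) C0 (Cmul (Cmul (RtoC (INR k)) (Cpow a (k - 1))) b) C0.
Proof.
  induction k as [|k IH].
  - apply bidual_eq; simpl; try ring. change (RtoC 0) with C0; ring.
  - cbn [Bpow]. rewrite IH. replace (S k - 1)%nat with k by lia.
    rewrite S_INR.
    replace (RtoC (INR k + 1)) with (Cadd (RtoC (INR k)) C1) by C_solve.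
    apply bidual_eq; simpl; try ring.
    destruct k; simpl; [change (RtoC 0) with C0; ring|]. rewrite Nat.sub_0_r. ring.
Qed.

Lemma Bmon_e al x z j :
  Bmon al (fun k => mkB (x k) (z k) C0 C0) j = mkB (monev al x j) (mdir al x z j) C0 C0.
Proof.
  revert j; induction al as [|a r IH]; intros j; [reflexivity|].
  cbn [Bmon monev mdir]. rewrite IH, Bpow_e. apply bidual_eq; simpl; ring.
Qed.

Lemma Bmon_h al x z j :
  Bmon al (fun k => mkB (x k) C0 (z k) C0) j = mkB (monev al x j) C0 (mdir al x z j) C0.
Proof.
  revert j; induction al as [|a r IH]; intros j; [reflexivity|].
  cbn [Bmon monev mdir]. rewrite IH, Bpow_h. apply bidual_eq; simpl; ring.
Qed.

Lemma Bpow_mul a b k : Bpow (Bmul a b) k = Bmul (Bpow a k) (Bpow b k).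
Proof. induction k; simpl; [ring | rewrite IHk; ring]. Qed.

Lemma Bmon_mul al X Y j :
  Bmon al (fun k => Bmul (X k) (Y k)) j = Bmul (Bmon al X j) (Bmon al Y j).
Proof.
  revert j; induction al as [|a r IH]; intros j; simpl; [ring|].
  rewrite IH, Bpow_mul; ring.
Qed.

Lemma Cconj_pow a k : Cconj (Cpow a k) = Cpow (Cconj a) k.
Proof. induction k; simpl; [C_solve | rewrite Cconj_mul, IHk; auto]. Qed.

Lemma Cconj_monev al x j : monev al (fun k => Cconj (x k)) j = Cconj (monev al x j).
Proof.
  revert j; induction al as [|a r IH]; intros j; simpl; [C_solve|].
  rewrite IH, Cconj_mul, Cconj_pow; auto.
Qed.

Lemma Cconj_mdir al x z j :
  mdir al (fun k => Cconj (x k)) (fun k => Cconj (z k)) j = Cconj (mdir al x z j).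
Proof.
  revert j; induction al as [|a r IH]; intros j; simpl; [C_solve|].
  rewrite IH, Cconj_monev, Cconj_add, !Cconj_mul, !Cconj_pow.
  replace (Cconj (RtoC (INR a))) with (RtoC (INR a)) by C_solve. auto.
Qed.

Lemma bd0_Bpow P k : bd0 (Bpow P k) = Cpow (bd0 P) k.
Proof. induction k; simpl; [auto | rewrite IHk; auto]. Qed.

Lemma bd1_Bpow P k :
  bd1 (Bpow P (S k)) = Cmul (RtoC (INR (S k))) (Cmul (Cpow (bd0 P) k) (bd1 P)).
Proof.
  induction k as [|k IH]; [simpl; change (RtoC 1) with C1; ring|].
  change (bd1 (Bpow P (S (S k)))) with
    (Cadd (Cmul (bd0 P) (bd1 (Bpow P (S k)))) (Cmul (bd1 P) (bd0 (Bpow P (S k))))).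
  rewrite IH, bd0_Bpow, (S_INR (S k)).
  replace (RtoC (INR (S k) + 1)) with (Cadd (RtoC (INR (S k))) C1) by C_solve.
  cbn [Cpow]; ring.
Qed.

Lemma bd2_Bpow P k :
  bd2 (Bpow P (S k)) = Cmul (RtoC (INR (S k))) (Cmul (Cpow (bd0 P) k) (bd2 P)).
Proof.
  induction k as [|k IH]; [simpl; change (RtoC 1) with C1; ring|].
  change (bd2 (Bpow P (S (S k)))) with
    (Cadd (Cmul (bd0 P) (bd2 (Bpow P (S k)))) (Cmul (bd2 P) (bd0 (Bpow P (S k))))).
  rewrite IH, bd0_Bpow, (S_INR (S k)).
  replace (RtoC (INR (S k) + 1)) with (Cadd (RtoC (INR (S k))) C1) by C_solve.
  cbn [Cpow]; ring.
Qed.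

(** Source of the two terms of the Gram formula: e h arises either from one factor contributing its
    [bd12], or from two different factors contributing [bd1] and [bd2]. *)
Lemma bd12_Bpow P k :
  bd12 (Bpow P (S k)) =
  Cmul (RtoC (INR (S k)))
    (Cadd (Cmul (Cpow (bd0 P) k) (bd12 P))
          (Cmul (RtoC (INR k)) (Cmul (Cpow (bd0 P) (k - 1)) (Cmul (bd1 P) (bd2 P))))).
Proof.
  induction k as [|k IH].
  - simpl; change (RtoC 1) with C1; change (RtoC 0) with C0; ring.
  - change (bd12 (Bpow P (S (S k)))) with
      (Cadd (Cadd (Cmul (bd0 P) (bd12 (Bpow P (S k)))) (Cmul (bd12 P) (bd0 (Bpow P (S k)))))
            (Cadd (Cmul (bd1 P) (bd2 (Bpow P (S k)))) (Cmul (bd2 P) (bd1 (Bpow P (S k)))))).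
    rewrite IH, bd0_Bpow, bd1_Bpow, bd2_Bpow.
    replace (S k - 1)%nat with k by lia.
    rewrite (S_INR (S k)), !(S_INR k).
    replace (RtoC (INR k + 1 + 1)) with (Cadd (RtoC (INR k)) (Cadd C1 C1)) by C_solve.
    replace (RtoC (INR k + 1)) with (Cadd (RtoC (INR k)) C1) by C_solve.
    destruct k as [|k].
    + simpl; change (RtoC 0) with C0; ring.
    + replace (S k - 1)%nat with k by lia. cbn [Cpow]; ring.
Qed.

Lemma bw_weight_pos al d : 0 < bw_weight al d.
Proof.
  apply Rdiv_lt_0_compat; [apply INR_factl_pos | apply INR_fact_lt_0].
Qed.

(* The coefficient of e h in the multinomial expansion of <x + e z, y + h w>^d. *)
Lemma mdir_gram m d x z y w :
  Csuml (monos m (S d)) (fun al =>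
    Cmul (RtoC (/ bw_weight al (S d))) (Cmul (mdir al x z 0) (Cconj (mdir al y w 0))))
  = Cmul (RtoC (INR (S d)))
      (Cadd (Cmul (Cpow (herm m x y) d) (herm m z w))
        (Cmul (RtoC (INR d))
          (Cmul (Cpow (herm m x y) (d - 1)) (Cmul (herm m z y) (herm m x w))))).
Proof.
  (* The sum of these products is the pairing of x + e z with y + h w, where h is treated as real:
     conjugation acts on [y] and [w] only. *)
  set (X := fun k => Bmul (mkB (x k) (z k) C0 C0) (mkB (Cconj (y k)) C0 (Cconj (w k)) C0)).
  assert (E := f_equal bd12 (bidual_multinomial m (S d) X 0)).
  rewrite bd12_Bsuml in E. unfold divpow in E.
  assert (P0 : bd0 (Bsuml (seq 0 m) X) = herm m x y).
  { rewrite bd0_Bsuml; unfold herm; rewrite Csumn_seq; apply Csuml_ext; intros; simpl; ring. }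
  assert (P1 : bd1 (Bsuml (seq 0 m) X) = herm m z y).
  { rewrite bd1_Bsuml; unfold herm; rewrite Csumn_seq; apply Csuml_ext; intros; simpl; ring. }
  assert (P2 : bd2 (Bsuml (seq 0 m) X) = herm m x w).
  { rewrite bd2_Bsuml; unfold herm; rewrite Csumn_seq; apply Csuml_ext; intros; simpl; ring. }
  assert (P3 : bd12 (Bsuml (seq 0 m) X) = herm m z w).
  { rewrite bd12_Bsuml; unfold herm; rewrite Csumn_seq; apply Csuml_ext; intros; simpl; ring. }
  rewrite <- P0, <- P1, <- P2, <- P3, <- bd12_Bpow.
  assert (Hr : forall r a, bd12 (Bmul (Breal r) a) = Cmul (RtoC r) (bd12 a))
    by (intros; simpl; ring).
  rewrite Hr in E.
  (* The weight is al! / d!, whereas the multinomial identity carries 1 / al! on one side and 1 / d!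
     on the other; multiplying by d! reconciles them. *)
  transitivity (Cmul (RtoC (INR (fact (S d)))) 
    (Cmul (RtoC (/ INR (fact (S d)))) (bd12 (Bpow (Bsuml (seq 0 m) X) (S d))))).
  - rewrite <- E, <- Csuml_scal. apply Csuml_ext; intros al _.
    rewrite Hr. unfold X. rewrite Bmon_mul, Bmon_e, Bmon_h, Cconj_mdir, Cconj_monev.
    replace (RtoC (/ bw_weight al (S d)))
      with (Cmul (RtoC (INR (fact (S d)))) (RtoC (/ INR (factl al)))).
    + cbn [bd12 bd1 bd2 bd0 Bmul]; ring.
    + rewrite <- RtoC_mul; f_equal. unfold bw_weight. fold (factl al).
      pose proof (INR_factl_pos al). pose proof (INR_fact_lt_0 (S d)).
      field; split; lra.
  - transitivity (Cmul (RtoC (INR (fact (S d)) * / INR (fact (S d))))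
      (bd12 (Bpow (Bsuml (seq 0 m) X) (S d)))).
    + rewrite RtoC_mul; ring.
    + rewrite Rinv_r by apply INR_fact_neq_0. change (RtoC 1) with C1; ring.
Qed.

(** * Hermitian geometry *)

Definition vnorm2 (m : nat) (x : vec) : R := Rsumn m (fun j => Cnorm2 (x j)).

Lemma vnorm2_ge0 m x : 0 <= vnorm2 m x.
Proof. apply Rsumn_ge0; intros; apply Cnorm2_ge0. Qed.

Lemma vnorm_sq m x : vnorm m x * vnorm m x = vnorm2 m x.
Proof. apply sqrt_sqrt, vnorm2_ge0. Qed.

Lemma vnorm_ge0 m x : 0 <= vnorm m x.
Proof. apply sqrt_pos. Qed.

Lemma vnorm2_eq0 m x : vnorm2 m x = 0 -> forall k, (k < m)%nat -> x k = C0.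
Proof.
  intros H k Hk. apply Cnorm2_eq0.
  pose proof (Rsumn_ge_term m (fun j => Cnorm2 (x j)) k (fun j _ => Cnorm2_ge0 (x j)) Hk).
  unfold vnorm2 in H. pose proof (Cnorm2_ge0 (x k)). simpl in *; lra.
Qed.

Lemma vnorm2_ext m x y : (forall k, (k < m)%nat -> x k = y k) -> vnorm2 m x = vnorm2 m y.
Proof. intros H; apply Rsumn_ext; intros; rewrite H; auto. Qed.

Lemma vnonzero_vnorm2 m x : vnonzero m x -> 0 < vnorm2 m x.
Proof.
  intros (j & Hj & H). apply Cnorm2_neq0 in H.
  pose proof (Rsumn_ge_term m (fun j => Cnorm2 (x j)) j (fun j _ => Cnorm2_ge0 (x j)) Hj).
  unfold vnorm2; simpl in *; lra.
Qed.

Lemma vnorm2_scal m l x : vnorm2 m (fun k => Cmul l (x k)) = Cnorm2 l * vnorm2 m x.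
Proof.
  unfold vnorm2; rewrite <- Rsumn_scal; apply Rsumn_ext; intros; apply Cnorm2_mul.
Qed.

Lemma vnorm_pos m x : 0 < vnorm2 m x -> 0 < vnorm m x.
Proof. intros; apply sqrt_lt_R0; auto. Qed.

Lemma herm_add_l m x y z :
  herm m (fun k => Cadd (x k) (y k)) z = Cadd (herm m x z) (herm m y z).
Proof. unfold herm; rewrite <- Csumn_add; apply Csumn_ext; intros; ring. Qed.

Lemma herm_scal_l m l x z : herm m (fun k => Cmul l (x k)) z = Cmul l (herm m x z).
Proof. unfold herm; rewrite <- Csumn_scal; apply Csumn_ext; intros; ring. Qed.

Lemma herm_sub_l m x y z :
  herm m (fun k => Csub (x k) (y k)) z = Csub (herm m x z) (herm m y z).
Proof.
  transitivity (Cadd (herm m x z) (Cmul (Copp C1) (herm m y z))); [|ring].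
  rewrite <- herm_scal_l, <- herm_add_l.
  unfold herm; apply Csumn_ext; intros; ring.
Qed.

Lemma herm_conj m x y : herm m y x = Cconj (herm m x y).
Proof.
  unfold herm. rewrite !Csumn_seq, Cconj_Csuml. apply Csuml_ext; intros.
  rewrite Cconj_mul. replace (Cconj (Cconj (y a))) with (y a) by C_solve. ring.
Qed.

Lemma herm_scal_r m l x z : herm m x (fun k => Cmul l (z k)) = Cmul (Cconj l) (herm m x z).
Proof. rewrite herm_conj, herm_scal_l, Cconj_mul, <- herm_conj; auto. Qed.

Lemma herm_sub_r m x y z :
  herm m z (fun k => Csub (x k) (y k)) = Csub (herm m z x) (herm m z y).
Proof. rewrite herm_conj, herm_sub_l, (herm_conj m x z), (herm_conj m y z). C_solve. Qed.

Lemma herm_self m x : herm m x x = RtoC (vnorm2 m x).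
Proof.
  unfold herm, vnorm2. induction m; simpl; [reflexivity|].
  rewrite IHm, Cmul_conj. C_solve.
Qed.

Lemma herm_Csumn_l m k c (xs : nat -> vec) y :
  herm m (fun j => Csumn k (fun l => Cmul (c l) (xs l j))) y
  = Csumn k (fun l => Cmul (c l) (herm m (xs l) y)).
Proof.
  induction k; cbn [Csumn].
  - apply Csumn_eq0; intros; ring.
  - rewrite herm_add_l, IHk, herm_scal_l; auto.
Qed.

Lemma Cauchy_Schwarz m x y : Cnorm2 (herm m x y) <= vnorm2 m x * vnorm2 m y.
Proof.
  unfold herm, vnorm2. rewrite Csumn_seq, !Rsumn_seq.
  eapply Rle_trans; [apply (weighted_Cauchy_Schwarz _ _ _ (fun _ => 1)); intros; lra|].
  right; f_equal; apply Rsuml_ext; intros; [|rewrite Cnorm2_conj]; field.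
Qed.

Lemma vnorm2_add m x y :
  vnorm2 m (fun k => Cadd (x k) (y k)) = vnorm2 m x + vnorm2 m y + 2 * re (herm m x y).
Proof.
  unfold vnorm2, herm. induction m; simpl; [ring|].
  rewrite IHm. unfold Cnorm2; simpl; ring.
Qed.

Lemma vnorm2_sub m x y :
  vnorm2 m (fun k => Csub (x k) (y k)) = vnorm2 m x + vnorm2 m y - 2 * re (herm m x y).
Proof.
  unfold vnorm2, herm. induction m; simpl; [ring|].
  rewrite IHm. unfold Cnorm2; simpl; ring.
Qed.

Lemma vnorm_triangle m x y :
  vnorm m (fun k => Cadd (x k) (y k)) <= vnorm m x + vnorm m y.
Proof.
  pose proof (vnorm_ge0 m x) as Hx; pose proof (vnorm_ge0 m y) as Hy.
  apply Rsqr_incr_0; [|apply vnorm_ge0|lra]. unfold Rsqr.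
  rewrite vnorm_sq, vnorm2_add.
  assert (re (herm m x y) <= vnorm m x * vnorm m y).
  { apply Rsqr_incr_0_var; [|nra]. unfold Rsqr.
    replace (vnorm m x * vnorm m y * (vnorm m x * vnorm m y))
      with ((vnorm m x * vnorm m x) * (vnorm m y * vnorm m y)) by ring.
    rewrite !vnorm_sq. eapply Rle_trans; [|apply Cauchy_Schwarz].
    unfold Cnorm2; nra. }
  rewrite <- !vnorm_sq. nra.
Qed.

Lemma vnorm_ext m x y : (forall k, (k < m)%nat -> x k = y k) -> vnorm m x = vnorm m y.
Proof. intros H; unfold vnorm; f_equal; apply vnorm2_ext; auto. Qed.

Lemma vnorm_scal m l x : vnorm m (fun k => Cmul l (x k)) = Cabs l * vnorm m x.
Proof.
  unfold vnorm. fold (vnorm2 m (fun k => Cmul l (x k))) (vnorm2 m x).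
  rewrite vnorm2_scal. apply sqrt_mult; [apply Cnorm2_ge0 | apply vnorm2_ge0].
Qed.

Lemma vnorm_Csumn_le m k c (xs : nat -> vec) :
  vnorm m (fun j => Csumn k (fun l => Cmul (c l) (xs l j)))
  <= Rsumn k (fun l => Cabs (c l) * vnorm m (xs l)).
Proof.
  induction k; cbn [Csumn Rsumn].
  - right. unfold vnorm. rewrite <- sqrt_0. f_equal.
    induction m; simpl; auto. rewrite IHm, Cnorm2_C0; lra.
  - eapply Rle_trans; [apply vnorm_triangle|]. rewrite vnorm_scal. lra.
Qed.

(* The component of [z] orthogonal to [y], for a unit vector [y]. *)
Definition proj (m : nat) (y z : vec) : vec :=
  fun k => Csub (z k) (Cmul (herm m z y) (y k)).

Lemma proj_orth m y z : vnorm2 m y = 1 -> orth m (proj m y z) y.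
Proof.
  intros H; unfold orth, proj. rewrite herm_sub_l, herm_scal_l, herm_self, H.
  change (RtoC 1) with C1; ring.
Qed.

Lemma vnorm2_proj m y z :
  vnorm2 m y = 1 -> vnorm2 m (proj m y z) = vnorm2 m z - Cnorm2 (herm m z y).
Proof.
  intros H; unfold proj. rewrite vnorm2_sub, vnorm2_scal, H, herm_scal_r.
  unfold Cnorm2; simpl; ring.
Qed.

Lemma herm_proj_l m y z w : orth m w y ->
  herm m (proj m y z) w = herm m z w.
Proof.
  intros H; unfold proj. rewrite herm_sub_l, herm_scal_l.
  rewrite (herm_conj m w y), H. replace (Cconj C0) with C0 by C_solve. ring.
Qed.

Lemma orth_scal_r m z l x : orth m z x -> orth m z (fun k => Cmul l (x k)).
Proof. unfold orth; intros H; rewrite herm_scal_r, H; ring. Qed.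

(** Since [z] is orthogonal to [x], it only sees the component of [y] orthogonal to [x], whose
    squared norm is 1 - c^2. *)
Lemma herm_orth_le m x y z c :
  vnorm2 m x = 1 -> vnorm2 m y = 1 -> herm m x y = RtoC c -> orth m z x ->
  Cnorm2 (herm m z y) <= vnorm2 m z * (1 - c * c).
Proof.
  intros Hx Hy Hc Hz.
  assert (Hyx : herm m y x = RtoC c) by (rewrite herm_conj, Hc; C_solve).
  replace (herm m z y) with (herm m z (proj m x y)).
  - eapply Rle_trans; [apply Cauchy_Schwarz|].
    rewrite vnorm2_proj, Hy, Hyx, Cnorm2_RtoC by auto. lra.
  - unfold proj. rewrite herm_sub_r, herm_scal_r, Hz. ring.
Qed.

(** * Linear algebra *)

(** The increasing enumeration of the indices other than [p], inverted by [unskip p]; used to remove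
    a pivot vector from a family. *)
Definition skip (p l : nat) : nat := if (l <? p)%nat then l else S l.
Definition unskip (p l : nat) : nat := if (l <? p)%nat then l else (l - 1)%nat.

Ltac skip_cases :=
  unfold skip, unskip in *;
  repeat match goal with
  | |- context [(?a <? ?b)%nat] => destruct (Nat.ltb_spec a b)
  | H : context [(?a <? ?b)%nat] |- _ => destruct (Nat.ltb_spec a b)
  end; try lia.

Lemma Csumn_skip k p h : (p <= k)%nat ->
  Csumn (S k) h = Cadd (h p) (Csumn k (fun l => h (skip p l))).
Proof.
  induction k as [|k IH]; intros Hp.
  - replace p with 0%nat by lia. simpl; ring.
  - change (Csumn (S (S k)) h) with (Cadd (Csumn (S k) h) (h (S k))).
    destruct (Nat.eq_dec p (S k)) as [->|Hn].
    + rewrite (Csumn_ext (S k) (fun l => h (skip (S k) l)) h); [ring|].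
      intros l Hl; f_equal; skip_cases.
    + rewrite IH by lia. cbn [Csumn].
      replace (skip p k) with (S k) by skip_cases. ring.
Qed.

(** Gaussian elimination on the last coordinate: multiples of a pivot vector clear it from the
    others, which are one fewer and live in one dimension less. *)
Lemma linear_dependence m : forall vs : nat -> vec,
  exists c : nat -> C, (exists l, (l < S m)%nat /\ c l <> C0) /\
    forall i, (i < m)%nat -> Csumn (S m) (fun l => Cmul (c l) (vs l i)) = C0.
Proof.
  induction m as [|m IH]; intros vs.
  - exists (fun _ => C1). split; [|intros; lia].
    exists 0%nat; split; [lia|]. intros E; apply (f_equal re) in E; simpl in E; lra.
  - assert (Hpivot : exists p r, (p <= S m)%nat /\
        forall l, (l < S m)%nat -> vs (skip p l) m = Cmul (r l) (vs p m)).
    { destruct (classic (exists p, (p <= S m)%nat /\ vs p m <> C0)) as [(p & Hp & H)|H].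
      - exists p, (fun l => Cmul (vs (skip p l) m) (Cinv (vs p m))). split; auto.
        intros l Hl.
        transitivity (Cmul (vs (skip p l) m) (Cmul (vs p m) (Cinv (vs p m)))); [|ring].
        rewrite Cmul_inv by auto; ring.
      - exists (S m), (fun _ => C0). split; auto. intros l Hl.
        assert (vs (skip (S m) l) m = C0) as ->; [|ring].
        apply NNPP; intros E; apply H. exists (skip (S m) l); split; auto. skip_cases. }
    destruct Hpivot as (p & r & Hp & Hr).
    destruct (IH (fun l i => Csub (vs (skip p l) i) (Cmul (r l) (vs p i))))
      as (c & (l0 & Hl0 & Hc0) & Hc).
    (* The pivot's coefficient collects the multiples of it that were subtracted from the other
       vectors. *)
    set (c' := fun k => if (k =? p)%nat
      then Copp (Csumn (S m) (fun l => Cmul (c l) (r l))) else c (unskip p k)).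
    assert (Hp' : c' p = Copp (Csumn (S m) (fun l => Cmul (c l) (r l))))
      by (unfold c'; rewrite Nat.eqb_refl; auto).
    assert (Hs : forall l, c' (skip p l) = c l).
    { intros l; unfold c'. destruct (Nat.eqb_spec (skip p l) p) as [E|E].
      - exfalso; skip_cases.
      - f_equal; skip_cases. }
    exists c'. split.
    + exists (skip p l0). split; [skip_cases | rewrite Hs; auto].
    + intros i Hi. rewrite (Csumn_skip (S m) p) by auto. rewrite Hp'.
      transitivity (Csumn (S m) (fun l =>
        Cmul (c l) (Csub (vs (skip p l) i) (Cmul (r l) (vs p i))))).
      * transitivity (Cadd (Csumn (S m) (fun l => Cmul (Copp (vs p i)) (Cmul (c l) (r l))))
          (Csumn (S m) (fun l => Cmul (c' (skip p l)) (vs (skip p l) i)))).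
        { rewrite Csumn_scal; ring. }
        rewrite <- Csumn_add. apply Csumn_ext; intros; rewrite Hs; ring.
      * destruct (Nat.eq_dec i m) as [->|].
        { apply Csumn_eq0; intros; rewrite Hr by auto; ring. }
        apply Hc; lia.
Qed.

(** Adding [b] to the family forces a dependence; by independence of [vs] the coefficient of [b] in
    it is nonzero, so [b] can be solved for. *)
Lemma independent_spanning m vs (b : vec) :
  lin_indep m m vs ->
  exists c, forall i, (i < m)%nat -> b i = Csumn m (fun l => Cmul (c l) (vs l i)).
Proof.
  intros Hind.
  destruct (linear_dependence m (fun l => if (l =? m)%nat then b else vs l))
    as (c & (l0 & Hl0 & Hc0) & Hc).
  assert (E : forall i, (i < m)%nat ->
    Cadd (Csumn m (fun l => Cmul (c l) (vs l i))) (Cmul (c m) (b i)) = C0).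
  { intros i Hi. rewrite <- (Hc i Hi). cbn [Csumn]. rewrite Nat.eqb_refl. f_equal.
    apply Csumn_ext; intros l Hl. destruct (Nat.eqb_spec l m); [lia|auto]. }
  assert (Hm : c m <> C0).
  { intros Hm. apply Hc0. destruct (Nat.eq_dec l0 m) as [->|]; auto.
    apply (Hind c); [|lia]. intros i Hi. rewrite <- (E i Hi), Hm; ring. }
  exists (fun l => Cmul (Copp (Cinv (c m))) (c l)). intros i Hi.
  transitivity (Cmul (Copp (Cinv (c m))) (Csumn m (fun l => Cmul (c l) (vs l i)))).
  - transitivity (Cmul (Cmul (c m) (Cinv (c m))) (b i)).
    + rewrite Cmul_inv by auto; ring.
    + specialize (E i Hi).
      transitivity (Cmul (Cinv (c m)) (Csub (Cadd (Csumn m (fun l => Cmul (c l) (vs l i)))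
        (Cmul (c m) (b i))) (Csumn m (fun l => Cmul (c l) (vs l i))))); [ring|].
      rewrite E; ring.
  - rewrite <- Csumn_scal. apply Csumn_ext; intros; ring.
Qed.

(** * The scaled derivative *)

Lemma Dfz_ext n d f x z z' i :
  (forall k, (k < S n)%nat -> z k = z' k) -> Dfz n d f x z i = Dfz n d f x z' i.
Proof.
  intros H; apply Csuml_ext; intros. f_equal.
  apply Csumn_ext; intros; rewrite H; auto.
Qed.

Lemma Dfz_add n d f x z z' i :
  Dfz n d f x (fun k => Cadd (z k) (z' k)) i = Cadd (Dfz n d f x z i) (Dfz n d f x z' i).
Proof.
  unfold Dfz; rewrite <- Csuml_add; apply Csuml_ext; intros al _.
  transitivity (Cmul (f i al) (Cadd (Csumn (S n) (fun k => Cmul (mondiff al x 0 k) (z k)))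
    (Csumn (S n) (fun k => Cmul (mondiff al x 0 k) (z' k))))); [|ring].
  f_equal. rewrite <- Csumn_add. apply Csumn_ext; intros; ring.
Qed.

Lemma Dfz_scal n d f x l z i :
  Dfz n d f x (fun k => Cmul l (z k)) i = Cmul l (Dfz n d f x z i).
Proof.
  unfold Dfz; rewrite <- Csuml_scal; apply Csuml_ext; intros al _.
  transitivity (Cmul (f i al) (Cmul l (Csumn (S n) (fun k => Cmul (mondiff al x 0 k) (z k)))));
    [|ring].
  f_equal. rewrite <- Csumn_scal. apply Csumn_ext; intros; ring.
Qed.

Lemma Dfz_Csumn n d f x k c (zs : nat -> vec) i :
  Dfz n d f x (fun j => Csumn k (fun l => Cmul (c l) (zs l j))) i
  = Csumn k (fun l => Cmul (c l) (Dfz n d f x (zs l) i)).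
Proof.
  induction k; cbn [Csumn].
  - transitivity (Cmul C0 (Dfz n d f x (fun _ => C0) i)); [|ring].
    rewrite <- Dfz_scal. apply Dfz_ext; intros; ring.
  - rewrite Dfz_add, IHk, Dfz_scal; auto.
Qed.

Lemma monev_scal al l x j :
  monev al (fun k => Cmul l (x k)) j
  = Cmul (Cpow l (fold_right Nat.add 0%nat al)) (monev al x j).
Proof.
  revert j; induction al as [|a r IH]; intros j; simpl; [ring|].
  rewrite IH, Cpow_mul, Cpow_add; ring.
Qed.

(** The extra factor [l] on the left avoids the exponent |al| - 1, which would truncate for a
    constant monomial. *)
Lemma mdir_scal al l x z j :
  Cmul l (mdir al (fun k => Cmul l (x k)) z j)
  = Cmul (Cpow l (fold_right Nat.add 0%nat al)) (mdir al x z j).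
Proof.
  revert j; induction al as [|a r IH]; intros j; simpl; [ring|].
  rewrite monev_scal, !Cpow_mul, Cpow_add.
  match goal with |- Cmul l (Cadd ?u (Cmul ?v ?w)) = _ =>
    transitivity (Cadd (Cmul l u) (Cmul v (Cmul l w))); [ring|] end.
  rewrite IH. destruct a as [|a]; simpl.
  - change (RtoC 0) with C0; ring.
  - rewrite Nat.sub_0_r; ring.
Qed.

Lemma Dfz_homogeneous n d f l x z i :
  Cmul l (Dfz n d f (fun k => Cmul l (x k)) z i) = Cmul (Cpow l (d i)) (Dfz n d f x z i).
Proof.
  rewrite !Dfz_mdir, <- !Csuml_scal. apply Csuml_ext; intros al Hal.
  apply in_monos in Hal; destruct Hal as [_ Hd].
  transitivity (Cmul (f i al) (Cmul l (mdir al (fun k => Cmul l (x k)) z 0))); [ring|].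
  rewrite mdir_scal, Hd; ring.
Qed.

Definition scale (n : nat) (d : nat -> nat) (x : vec) (i : nat) : R :=
  sqrt (INR (d i)) * vnorm (S n) x ^ (d i - 1).

(** The inverse of the operator in the definition of mu: diag(sqrt d_i |x|^(d_i - 1))^(-1) composed
    with Df(x). *)
Definition sderiv (n : nat) (d : nat -> nat) (f : system) (x z : vec) : vec :=
  fun i => Cmul (RtoC (/ scale n d x i)) (Dfz n d f x z i).

Definition degrees_pos (n : nat) (d : nat -> nat) := forall i, (i < n)%nat -> (1 <= d i)%nat.

Lemma scale_pos n d x i : (1 <= d i)%nat -> 0 < vnorm2 (S n) x -> 0 < scale n d x i.
Proof.
  intros Hd Hx. apply Rmult_lt_0_compat.
  - apply sqrt_lt_R0, lt_0_INR; lia.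
  - apply pow_lt, vnorm_pos; auto.
Qed.

Lemma scale_unit n d x i : vnorm2 (S n) x = 1 -> scale n d x i = sqrt (INR (d i)).
Proof.
  intros H; unfold scale, vnorm. fold (vnorm2 (S n) x).
  rewrite H, sqrt_1, pow1; ring.
Qed.

Lemma Dfz_sderiv n d f x z i :
  (1 <= d i)%nat -> 0 < vnorm2 (S n) x ->
  Dfz n d f x z i = Cmul (RtoC (scale n d x i)) (sderiv n d f x z i).
Proof.
  intros Hd Hx; pose proof (scale_pos n d x i Hd Hx). unfold sderiv.
  transitivity (Cmul (RtoC (scale n d x i * / scale n d x i)) (Dfz n d f x z i)).
  - rewrite Rinv_r by lra. change (RtoC 1) with C1; ring.
  - rewrite RtoC_mul; ring.
Qed.

Lemma sderiv_scal n d f x l z i :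
  sderiv n d f x (fun k => Cmul l (z k)) i = Cmul l (sderiv n d f x z i).
Proof. unfold sderiv; rewrite Dfz_scal; ring. Qed.

(** The derivative has degree d_i - 1 in [x] and [scale] grows by the same power of |l|; only a
    phase is left, which the norm ignores. This permits replacing [x] by any multiple, in particular
    by a unit vector of suitable phase. *)
Lemma vnorm_sderiv_homogeneous n d f l x z :
  degrees_pos n d -> 0 < vnorm2 (S n) x -> l <> C0 ->
  vnorm n (sderiv n d f (fun k => Cmul l (x k)) z) = vnorm n (sderiv n d f x z).
Proof.
  intros Hd Hx Hl. unfold vnorm; f_equal. apply Rsumn_ext; intros i Hi.
  specialize (Hd i Hi). unfold sderiv. rewrite !Cnorm2_mul, !Cnorm2_RtoC.
  assert (Hl2 := Cnorm2_neq0 l Hl).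
  assert (Hl1 : 0 < Cabs l) by (apply sqrt_lt_R0; auto).
  assert (Hla : Cabs l * Cabs l = Cnorm2 l) by (apply sqrt_sqrt; lra).
  assert (H := f_equal Cnorm2 (Dfz_homogeneous n d f l x z i)).
  rewrite !Cnorm2_mul, Cnorm2_pow in H.
  assert (Hs : scale n d (fun k => Cmul l (x k)) i = Cabs l ^ (d i - 1) * scale n d x i).
  { unfold scale. rewrite vnorm_scal, Rpow_mult_distr; ring. }
  pose proof (scale_pos n d x i Hd Hx) as Hs0. rewrite Hs.
  set (s := scale n d x i) in *.
  set (p := Cnorm2 (Dfz n d f (fun k => Cmul l (x k)) z i)) in *.
  set (q := Cnorm2 (Dfz n d f x z i)) in *.
  assert (Hpow : 0 < Cabs l ^ (d i - 1)) by (apply pow_lt; auto).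
  assert (Hp : p = Cabs l ^ (d i - 1) * Cabs l ^ (d i - 1) * q).
  { replace (d i) with (S (d i - 1)) in H by lia. simpl in H.
    apply Rmult_eq_reg_l with (Cnorm2 l); [|lra].
    rewrite <- Rpow_mult_distr, Hla.
    replace (S (d i - 1) - 1)%nat with (d i - 1)%nat in H by lia.
    rewrite H; ring. }
  rewrite Hp. field; split; lra.
Qed.

(** * Bombieri-Weyl bounds for the derivative *)

Definition pnorm2 (n di : nat) (p : poly) : R :=
  Rsuml (monos (S n) di) (fun al => bw_weight al di * Cnorm2 (p al)).

Lemma pnorm2_ge0 n di p : 0 <= pnorm2 n di p.
Proof.
  apply Rsuml_ge0; intros al _.
  pose proof (bw_weight_pos al di); pose proof (Cnorm2_ge0 (p al)); nra.
Qed.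

Lemma normH_sq n d f : normH n d f * normH n d f = Rsumn n (fun i => pnorm2 n (d i) (f i)).
Proof. apply sqrt_sqrt, Rsumn_ge0; intros; apply pnorm2_ge0. Qed.

Lemma normH_ge0 n d f : 0 <= normH n d f.
Proof. apply sqrt_pos. Qed.

(** On the diagonal the second Gram term contains <z, x> = 0, so the squared norm of a
    representative is d |z|^2. *)
Lemma mdir_gram_diag m e x z :
  vnorm2 m x = 1 -> orth m z x ->
  Rsuml (monos m (S e)) (fun al => / bw_weight al (S e) * Cnorm2 (mdir al x z 0))
  = INR (S e) * vnorm2 m z.
Proof.
  intros Hx Hz.
  transitivity (re (Csuml (monos m (S e)) (fun al =>
    Cmul (RtoC (/ bw_weight al (S e))) (Cmul (mdir al x z 0) (Cconj (mdir al x z 0)))))).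
  - rewrite re_Csuml. apply Rsuml_ext; intros. rewrite Cmul_conj. simpl; ring.
  - rewrite mdir_gram, !herm_self, Hx, Hz, Cpow_RtoC, pow1. simpl; ring.
Qed.

Lemma Dfz_bound n d f x z i :
  (1 <= d i)%nat -> vnorm2 (S n) x = 1 -> orth (S n) z x ->
  Cnorm2 (Dfz n d f x z i) <= pnorm2 n (d i) (f i) * (INR (d i) * vnorm2 (S n) z).
Proof.
  intros Hd Hx Hz. rewrite Dfz_mdir.
  eapply Rle_trans.
  { apply (weighted_Cauchy_Schwarz _ _ _ (fun al => bw_weight al (d i))).
    intros; apply bw_weight_pos. }
  right; unfold pnorm2; f_equal.
  destruct (d i) as [|e]; [lia|]. apply mdir_gram_diag; auto.
Qed.

(** Bernoulli's inequality; it makes the power <x, y>^(d-1) cost only a factor linear in d. *)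
Lemma Bernoulli_le c e : 0 <= c <= 1 -> 0 <= c ^ e <= 1 /\ 1 - c ^ e <= INR e * (1 - c).
Proof.
  intros Hc; induction e as [|e IH]; [simpl; lra|].
  rewrite S_INR; simpl pow. nra.
Qed.

(* Both terms of the Gram formula are explicit because <x, y> = c is real and
   <z, w> = |w|^2, <x, w> = - c conj <z, y> for the projection w of z. *)
Lemma Dfz_variation n d f x y z i c :
  (1 <= d i)%nat -> vnorm2 (S n) x = 1 -> vnorm2 (S n) y = 1 ->
  herm (S n) x y = RtoC c -> 0 <= c <= 1 -> orth (S n) z x ->
  Cnorm2 (Csub (Dfz n d f x z i) (Dfz n d f y (proj (S n) y z) i))
  <= pnorm2 n (d i) (f i) * (INR (d i) * (3 * INR (d i) * (2 * (1 - c)) * vnorm2 (S n) z)).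
Proof.
  intros Hd Hx Hy Hc Hc01 Hz. set (w := proj (S n) y z).
  set (T := fun al => Csub (mdir al x z 0) (mdir al y w 0)).
  replace (Csub (Dfz n d f x z i) (Dfz n d f y w i))
    with (Csuml (monos (S n) (d i)) (fun al => Cmul (f i al) (T al))).
  2:{ transitivity (Cadd (Dfz n d f x z i) (Cmul (Copp C1) (Dfz n d f y w i))); [|ring].
      rewrite !Dfz_mdir, <- Csuml_scal, <- Csuml_add.
      apply Csuml_ext; intros; unfold T; ring. }
  eapply Rle_trans.
  { apply (weighted_Cauchy_Schwarz _ _ _ (fun al => bw_weight al (d i))).
    intros; apply bw_weight_pos. }
  apply Rmult_le_compat_l; [apply pnorm2_ge0|].
  destruct (d i) as [|e]; [lia|].
  assert (Hw : orth (S n) w y) by (apply proj_orth; auto).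
  set (q := herm (S n) z y).
  assert (Hw2 : vnorm2 (S n) w = vnorm2 (S n) z - Cnorm2 q) by (apply vnorm2_proj; auto).
  assert (Hzw : herm (S n) z w = RtoC (vnorm2 (S n) w)).
  { rewrite <- herm_self, <- (herm_proj_l (S n) y z w) by auto; auto. }
  assert (Hxw : herm (S n) x w = Copp (Cmul (Cconj q) (RtoC c))).
  { unfold w, proj. rewrite herm_sub_r, herm_scal_r, Hc, (herm_conj (S n) z x), Hz.
    fold q. C_solve. }
  assert (Hq : Cnorm2 q <= vnorm2 (S n) z * (1 - c * c))
    by (apply (herm_orth_le (S n) x y z c); auto).
  pose proof (mdir_gram_diag (S n) e x z Hx Hz) as G1.
  pose proof (mdir_gram_diag (S n) e y w Hy Hw) as G2.
  pose proof (f_equal re (mdir_gram (S n) e x z y w)) as G3.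
  rewrite re_Csuml, Hc, Hzw, Hxw, Cpow_RtoC in G3. fold q in G3.
  (* Squared distance of the two representatives, expanded as |a|^2 + |b|^2 - 2 Re <a, b>. *)
  assert (G : Rsuml (monos (S n) (S e)) (fun al => / bw_weight al (S e) * Cnorm2 (T al))
    = INR (S e) * (vnorm2 (S n) z + vnorm2 (S n) w
        - 2 * (c ^ e * vnorm2 (S n) w - INR e * c ^ e * Cnorm2 q))).
  { match type of G3 with _ = ?rhs =>
      replace (INR (S e) * (vnorm2 (S n) z + vnorm2 (S n) w
        - 2 * (c ^ e * vnorm2 (S n) w - INR e * c ^ e * Cnorm2 q)))
      with (INR (S e) * vnorm2 (S n) z + INR (S e) * vnorm2 (S n) w + (-2) * rhs) end.
    - rewrite <- G1, <- G2, <- G3, <- Rsuml_scal, <- !Rsuml_add.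
      apply Rsuml_ext; intros; unfold T, Cnorm2; simpl; ring.
    (* For degree 1 the mixed term has the factor 0; otherwise its power c^(e-1) absorbs the [c]
       coming from [Hxw]. *)
    - rewrite Cpow_RtoC. destruct e as [|e]; [simpl; unfold Cnorm2; ring|].
      replace (S e - 1)%nat with e by lia.
      unfold Cnorm2; cbn [re im RtoC Cmul Cadd Copp Cconj pow]; ring. }
  rewrite G. apply Rmult_le_compat_l; [apply pos_INR|].
  pose proof (Bernoulli_le c e Hc01) as [Hce Hb].
  pose proof (vnorm2_ge0 (S n) z) as Zp. pose proof (Cnorm2_ge0 q) as Qp.
  pose proof (vnorm2_ge0 (S n) w) as Wp. pose proof (pos_INR e) as Ep.
  rewrite Hw2 in *. rewrite S_INR.
  set (Z := vnorm2 (S n) z) in *. set (Q := Cnorm2 q) in *. set (E := INR e) in *.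
  set (ce := c ^ e) in *.
  (* The bracket equals 2 (Z - Q) (1 - ce) + Q + 2 E ce Q. With tau = 2 (1 - c) Z these three pieces
     are at most E tau, tau and 2 E tau, and 3 E + 1 <= 3 (E + 1) is the origin of the constant
     3. *)
  assert (HQ : Q <= 2 * (1 - c) * Z) by nra.
  assert (H1 : 2 * (Z - Q) * (1 - ce) <= 2 * Z * (E * (1 - c))) by nra.
  assert (H2 : E * ce * Q <= E * Q) by (assert (0 <= E * Q) by nra; nra).
  assert (H3 : E * Q <= E * (2 * (1 - c) * Z)) by nra.
  assert (H4 : 0 <= (1 - c) * Z) by nra.
  nra.
Qed.

Lemma vnorm_le_of_sq m x b : 0 <= b -> vnorm2 m x <= b * b -> vnorm m x <= b.
Proof.
  intros Hb H. apply Rsqr_incr_0_var; auto. unfold Rsqr; rewrite vnorm_sq; auto.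
Qed.

(** The factor sqrt d_i in [scale] cancels exactly the d_i of [Dfz_bound], so no degree survives. *)
Lemma sderiv_bound_unit n d f x z :
  degrees_pos n d -> vnorm2 (S n) x = 1 -> orth (S n) z x ->
  vnorm n (sderiv n d f x z) <= normH n d f * vnorm (S n) z.
Proof.
  intros Hd Hx Hz. apply vnorm_le_of_sq.
  { apply Rmult_le_pos; [apply normH_ge0 | apply vnorm_ge0]. }
  replace (normH n d f * vnorm (S n) z * (normH n d f * vnorm (S n) z))
    with ((vnorm (S n) z * vnorm (S n) z) * (normH n d f * normH n d f)) by ring.
  rewrite vnorm_sq, normH_sq, <- Rsumn_scal. apply Rsumn_le; intros i Hi.
  specialize (Hd i Hi). unfold sderiv. rewrite scale_unit by auto.
  rewrite Cnorm2_mul, Cnorm2_RtoC.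
  assert (Hp : 0 < INR (d i)) by (apply lt_0_INR; lia).
  rewrite <- Rinv_mult, sqrt_sqrt by lra.
  pose proof (Dfz_bound n d f x z i Hd Hx Hz) as HB.
  apply Rmult_le_reg_l with (INR (d i)); auto.
  rewrite <- Rmult_assoc, Rinv_r by lra. lra.
Qed.

Lemma Dmax_ge n d i : (i < n)%nat -> (d i <= Dmax n d)%nat.
Proof.
  induction n; simpl; intros; [lia|].
  destruct (Nat.eq_dec i n) as [->|]; [lia|]. specialize (IHn ltac:(lia)); lia.
Qed.

Lemma sderiv_variation n d f x y z c t :
  degrees_pos n d -> vnorm2 (S n) x = 1 -> vnorm2 (S n) y = 1 ->
  herm (S n) x y = RtoC c -> 0 <= c <= 1 -> 0 <= t -> 2 * (1 - c) <= t * t ->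
  orth (S n) z x ->
  vnorm n (fun i => Csub (sderiv n d f x z i) (sderiv n d f y (proj (S n) y z) i))
  <= sqrt (3 * INR (Dmax n d)) * t * normH n d f * vnorm (S n) z.
Proof.
  intros Hd Hx Hy Hc Hc01 Ht Hct Hz. apply vnorm_le_of_sq.
  { repeat apply Rmult_le_pos; auto using sqrt_pos, normH_ge0, vnorm_ge0. }
  set (D := INR (Dmax n d)).
  assert (HD : 0 <= D) by apply pos_INR.
  replace (sqrt (3 * D) * t * normH n d f * vnorm (S n) z *
           (sqrt (3 * D) * t * normH n d f * vnorm (S n) z))
    with ((sqrt (3 * D) * sqrt (3 * D)) * (t * t) * (vnorm (S n) z * vnorm (S n) z)
          * (normH n d f * normH n d f)) by ring.
  rewrite sqrt_sqrt by lra. rewrite vnorm_sq, normH_sq, <- Rsumn_scal.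
  apply Rsumn_le; intros i Hi.
  assert (Hdi := Hd i Hi).
  assert (Hp : 0 < INR (d i)) by (apply lt_0_INR; lia).
  assert (HDi : INR (d i) <= D) by (apply le_INR, Dmax_ge; auto).
  unfold sderiv. rewrite !scale_unit by auto.
  match goal with |- Cnorm2 (Csub (Cmul ?s ?a) (Cmul ?s ?b)) <= _ =>
    replace (Csub (Cmul s a) (Cmul s b)) with (Cmul s (Csub a b)) by ring end.
  rewrite Cnorm2_mul, Cnorm2_RtoC, <- Rinv_mult, sqrt_sqrt by lra.
  pose proof (Dfz_variation n d f x y z i c Hdi Hx Hy Hc Hc01 Hz) as HB.
  pose proof (pnorm2_ge0 n (d i) (f i)) as HP. pose proof (vnorm2_ge0 (S n) z) as HZ.
  apply Rmult_le_reg_l with (INR (d i)); auto.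
  rewrite <- Rmult_assoc, Rinv_r, Rmult_1_l by lra.
  eapply Rle_trans; [apply HB|].
  replace (pnorm2 n (d i) (f i) *
    (INR (d i) * (3 * INR (d i) * (2 * (1 - c)) * vnorm2 (S n) z)))
    with (INR (d i) * (INR (d i) * (2 * (1 - c)) * (3 * vnorm2 (S n) z * pnorm2 n (d i) (f i))))
    by ring.
  apply Rmult_le_compat_l; [lra|].
  replace (3 * D * (t * t) * vnorm2 (S n) z * pnorm2 n (d i) (f i))
    with (D * (t * t) * (3 * vnorm2 (S n) z * pnorm2 n (d i) (f i))) by ring.
  apply Rmult_le_compat_r.
  - apply Rmult_le_pos; auto; lra.
  - apply Rmult_le_compat; lra.
Qed.

(** * The condition number *)

(** A component of degree 0 has zero derivative, so the image would miss every vector with a nonzero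
    entry there. Positive degrees make [scale] invertible. *)
Lemma rank_degrees_pos n d f x : rank_ge n d f x n -> degrees_pos n d.
Proof.
  intros (zs & _ & Hind) i Hi.
  destruct (d i) eqn:Hd; [|lia]. exfalso.
  destruct (independent_spanning n _ (fun _ => C1) Hind) as (c & Hc).
  specialize (Hc i Hi). simpl in Hc. rewrite Csumn_eq0 in Hc.
  - apply (f_equal re) in Hc; simpl in Hc; lra.
  - intros l _.
    enough (Dfz n d f x (zs l) i = C0) as -> by ring.
    rewrite Dfz_mdir. transitivity (Csuml (monos (S n) (d i)) (fun _ => Cmul C0 C0)).
    2: rewrite Csuml_scal; ring.
    apply Csuml_ext; intros al Hal. apply in_monos in Hal; destruct Hal as [_ Hs].
    rewrite Hd in Hs.
    enough (forall j, mdir al x (zs l) j = C0) as -> by ring.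
    clear -Hs. induction al as [|a r IH]; intros j; simpl in *; auto.
    rewrite IH by lia. replace a with 0%nat by lia. simpl.
    change (RtoC 0) with C0; ring.
Qed.

(** The n + 2 vectors [zs], [z], [x] in dimension n + 1 are dependent. Pairing the relation with [x]
    kills the coefficient of [x], applying Df(x) kills those of [zs], and what remains is a nonzero
    multiple of [z]. *)
Lemma kernel_trivial n d f x z :
  rank_ge n d f x n -> 0 < vnorm2 (S n) x -> orth (S n) z x ->
  (forall i, (i < n)%nat -> Dfz n d f x z i = C0) ->
  forall k, (k < S n)%nat -> z k = C0.
Proof.
  intros (zs & Hzs & Hind) Hx Hz HD.
  set (vs := fun l => if (l <? n)%nat then zs l else if (l =? n)%nat then z else x).
  destruct (linear_dependence (S n) vs) as (c & (l0 & Hl0 & Hc0) & Hc).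
  assert (Hvn : vs n = z) by (unfold vs; rewrite Nat.ltb_irrefl, Nat.eqb_refl; auto).
  assert (HvS : vs (S n) = x).
  { unfold vs. destruct (Nat.ltb_spec (S n) n); [lia|].
    destruct (Nat.eqb_spec (S n) n); [lia|auto]. }
  assert (Hvl : forall l, (l < n)%nat -> vs l = zs l).
  { intros l Hl; unfold vs. destruct (Nat.ltb_spec l n); [auto|lia]. }
  assert (Hcx : c (S n) = C0).
  { assert (E := herm_Csumn_l (S n) (S (S n)) c vs x).
    cbn [Csumn] in E. rewrite HvS, Hvn, Hz, herm_self in E.
    rewrite (Csumn_eq0 n) in E by (intros l Hl; rewrite (Hvl l Hl), (Hzs l Hl); ring).
    transitivity (Cmul C1 (c (S n))); [ring|].
    apply Cmul_integral with (RtoC (vnorm2 (S n) x)); [|apply RtoC_neq0; lra].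
    transitivity (Cadd (Cadd C0 (Cmul (c n) C0)) (Cmul (c (S n)) (RtoC (vnorm2 (S n) x)))); [ring|].
    rewrite <- E. apply Csumn_eq0. intros k Hk.
    specialize (Hc k Hk). cbn [Csumn] in Hc. rewrite HvS, Hvn in Hc. rewrite Hc. ring. }
  assert (Hcl : forall l, (l < n)%nat -> c l = C0).
  { apply Hind. intros i Hi.
    assert (E := Dfz_Csumn n d f x (S (S n)) c vs i).
    rewrite (Dfz_ext n d f x _ (fun k => Cmul C0 C0)) in E.
    2: intros k Hk; rewrite (Hc k Hk); ring.
    rewrite Dfz_scal in E. cbn [Csumn] in E. rewrite HvS, Hvn, Hcx, (HD i Hi) in E.
    rewrite (Csumn_ext n _ (fun l => Cmul (c l) (Dfz n d f x (zs l) i))) in E.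
    2: intros l Hl; rewrite (Hvl l Hl); auto.
    match type of E with _ = Cadd (Cadd ?s _) _ =>
      transitivity (Cadd (Cadd s (Cmul (c n) C0)) (Cmul C0 (Dfz n d f x x i))) end; [ring|].
    rewrite <- E; ring. }
  assert (Hcn : c n <> C0).
  { intros Hn; apply Hc0. destruct (Nat.lt_ge_cases l0 n); [auto|].
    assert (l0 = n \/ l0 = S n) as [->| ->] by lia; auto. }
  intros k Hk. apply Cmul_integral with (c n); auto.
  specialize (Hc k Hk). cbn [Csumn] in Hc. rewrite HvS, Hvn, Hcx in Hc.
  rewrite (Csumn_eq0 n) in Hc by (intros l Hl; rewrite (Hcl l Hl); ring).
  rewrite <- Hc; ring.
Qed.

Lemma sderiv_onto n d f x (w : vec) :
  rank_ge n d f x n -> 0 < vnorm2 (S n) x ->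
  exists z, orth (S n) z x /\
    forall i, (i < n)%nat -> Dfz n d f x z i = Cmul (RtoC (scale n d x i)) (w i).
Proof.
  intros (zs & Hzs & Hind) Hx.
  destruct (independent_spanning n _ (fun i => Cmul (RtoC (scale n d x i)) (w i)) Hind)
    as (c & Hc).
  exists (fun k => Csumn n (fun l => Cmul (c l) (zs l k))). split.
  - unfold orth. rewrite herm_Csumn_l. apply Csumn_eq0; intros l Hl.
    rewrite (Hzs l Hl); ring.
  - intros i Hi. rewrite Dfz_Csumn, <- (Hc i Hi). auto.
Qed.

(** The set inside [opnorm_inv], equal to it by unfolding [scale], so a least upper bound of one is
    one of the other by conversion. *)
Definition inverse_values n d f x : R -> Prop :=
  fun t => exists w z : vec,
    vnorm n w = 1 /\ orth (S n) z x /\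
    (forall i, (i < n)%nat -> Dfz n d f x z i = Cmul (RtoC (scale n d x i)) (w i)) /\
    t = vnorm (S n) z.

Lemma inverse_values_nonempty n d f x :
  (1 <= n)%nat -> rank_ge n d f x n -> 0 < vnorm2 (S n) x ->
  exists t, inverse_values n d f x t.
Proof.
  intros Hn Hr Hx.
  set (w := fun i => if (i =? 0)%nat then C1 else C0 : C).
  destruct (sderiv_onto n d f x w Hr Hx) as (z & Hz & HD).
  exists (vnorm (S n) z), w, z. repeat split; auto.
  unfold vnorm. rewrite <- sqrt_1. f_equal.
  destruct n as [|n]; [lia|]. clear. induction n as [|n IH].
  - unfold Cnorm2; simpl; ring.
  - cbn [Rsumn] in *. rewrite IH. unfold Cnorm2; simpl; ring.
Qed.

(** Every admissible [z] is, by triviality of the kernel, the combination with coefficients [w] of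
    fixed preimages [zeta] of the basis vectors; each |w_l| is at most |w| = 1. *)
Lemma inverse_values_bound n d f x :
  degrees_pos n d -> rank_ge n d f x n -> 0 < vnorm2 (S n) x ->
  bound (inverse_values n d f x).
Proof.
  intros Hd Hr Hx.
  assert (Hex : forall j, exists z, orth (S n) z x /\ forall i, (i < n)%nat ->
    Dfz n d f x z i = Cmul (RtoC (scale n d x i)) (if (i =? j)%nat then C1 else C0)).
  { intros j; apply (sderiv_onto n d f x (fun i => if (i =? j)%nat then C1 else C0)); auto. }
  set (zeta := fun j => proj1_sig (constructive_indefinite_description _ (Hex j))).
  assert (Hzeta : forall j, orth (S n) (zeta j) x /\ forall i, (i < n)%nat ->
    Dfz n d f x (zeta j) i = Cmul (RtoC (scale n d x i)) (if (i =? j)%nat then C1 else C0))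
    by (intros j; apply (proj2_sig (constructive_indefinite_description _ (Hex j)))).
  exists (Rsumn n (fun l => vnorm (S n) (zeta l))).
  intros t (w & z & Hw & Hz & HD & ->).
  set (z' := fun k => Csumn n (fun l => Cmul (w l) (zeta l k))).
  assert (HD' : forall i, (i < n)%nat -> Dfz n d f x z' i = Dfz n d f x z i).
  { intros i Hi. unfold z'. rewrite Dfz_Csumn, (HD i Hi).
    transitivity (Cmul (RtoC (scale n d x i))
      (Csumn n (fun l => Cmul (w l) (if (i =? l)%nat then C1 else C0)))).
    - rewrite <- Csumn_scal. apply Csumn_ext; intros l Hl.
      destruct (Hzeta l) as [_ ->]; auto; ring.
    - f_equal. destruct n as [|m]; [lia|].
      rewrite (Csumn_skip m i) by lia. rewrite Nat.eqb_refl.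
      rewrite Csumn_eq0; [ring|]. intros l Hl.
      destruct (Nat.eqb_spec i (skip i l)) as [E|]; [exfalso; skip_cases|ring]. }
  assert (Hz' : orth (S n) z' x).
  { unfold orth, z'. rewrite herm_Csumn_l. apply Csumn_eq0; intros l Hl.
    destruct (Hzeta l) as [-> _]; ring. }
  assert (Heq : forall k, (k < S n)%nat -> z k = z' k).
  { intros k Hk.
    assert (E : Cadd (z k) (Cmul (Copp C1) (z' k)) = C0).
    { apply (kernel_trivial n d f x (fun k => Cadd (z k) (Cmul (Copp C1) (z' k)))); auto.
      - unfold orth. rewrite herm_add_l, herm_scal_l, Hz, Hz'; ring.
      - intros i Hi. rewrite Dfz_add, Dfz_scal, HD' by auto; ring. }
    transitivity (Cadd (Cadd (z k) (Cmul (Copp C1) (z' k))) (z' k)); [ring|].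
    rewrite E; ring. }
  rewrite (vnorm_ext _ _ _ Heq).
  eapply Rle_trans; [apply vnorm_Csumn_le|]. apply Rsumn_le; intros l Hl.
  assert (Hwl : Cabs (w l) <= 1).
  { rewrite <- Hw. apply sqrt_le_1_alt.
    apply (Rsumn_ge_term n (fun j => Cnorm2 (w j))); auto.
    intros; apply Cnorm2_ge0. }
  pose proof (vnorm_ge0 (S n) (zeta l)). nra.
Qed.

(** [Rlub] is a choice operator and yields a supremum only once one exists; nonemptiness uses n >= 1
    and boundedness uses the rank. *)
Lemma opnorm_inv_lub n d f x :
  (1 <= n)%nat -> rank_ge n d f x n -> 0 < vnorm2 (S n) x ->
  is_lub (inverse_values n d f x) (opnorm_inv n d f x).
Proof.
  intros Hn Hr Hx.
  destruct (completeness (inverse_values n d f x)) as (m & Hm).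
  - apply inverse_values_bound; auto. eapply rank_degrees_pos; eauto.
  - apply inverse_values_nonempty; auto.
  - apply (epsilon_spec (inhabits 0) (fun m => is_lub (inverse_values n d f x) m)).
    exists m; auto.
Qed.

Lemma vnorm_eq0 m x : vnorm m x = 0 -> vnorm2 m x = 0.
Proof. intros H; rewrite <- vnorm_sq, H; ring. Qed.

Lemma Cabs_RtoC r : 0 <= r -> Cabs (RtoC r) = r.
Proof. intros; unfold Cabs; rewrite Cnorm2_RtoC; apply sqrt_square; auto. Qed.

(** Rescaling makes the scaled derivative of [z] a unit vector, unless it vanishes; then [z] is zero
    by [kernel_trivial]. With [opnorm_inv_least] this describes the operator norm without
    preimages. *)
Lemma opnorm_inv_bound n d f x z :
  (1 <= n)%nat -> rank_ge n d f x n -> 0 < vnorm2 (S n) x -> orth (S n) z x ->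
  vnorm (S n) z <= opnorm_inv n d f x * vnorm n (sderiv n d f x z).
Proof.
  intros Hn Hr Hx Hz.
  assert (Hd := rank_degrees_pos _ _ _ _ Hr).
  destruct (opnorm_inv_lub n d f x Hn Hr Hx) as [Hub _].
  destruct (vnorm_ge0 n (sderiv n d f x z)) as [Hp|H0].
  - set (r := vnorm n (sderiv n d f x z)) in *.
    assert (Hi : 0 < / r) by (apply Rinv_0_lt_compat; auto).
    apply Rmult_le_reg_l with (/ r); auto.
    replace (/ r * (opnorm_inv n d f x * r)) with (opnorm_inv n d f x) by (field; lra).
    apply Hub.
    exists (sderiv n d f x (fun k => Cmul (RtoC (/ r)) (z k))), (fun k => Cmul (RtoC (/ r)) (z k)).
    repeat split.
    + rewrite (vnorm_ext _ _ (fun i => Cmul (RtoC (/ r)) (sderiv n d f x z i)))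
        by (intros; apply sderiv_scal).
      rewrite vnorm_scal, Cabs_RtoC by lra. fold r. field; lra.
    + unfold orth; rewrite herm_scal_l, Hz; ring.
    + intros i Hi'. apply Dfz_sderiv; auto.
    + rewrite vnorm_scal, Cabs_RtoC by lra. auto.
  - rewrite <- H0. right.
    rewrite (vnorm_ext (S n) z (fun k => Cmul C0 C0)).
    + rewrite vnorm_scal. unfold Cabs; rewrite Cnorm2_C0, sqrt_0; ring.
    + intros k Hk. transitivity C0; [|ring].
      apply (kernel_trivial n d f x z); auto. intros i Hi.
      rewrite Dfz_sderiv by auto.
      rewrite (vnorm2_eq0 n _ (vnorm_eq0 _ _ (eq_sym H0))) by auto. ring.
Qed.

Lemma opnorm_inv_least n d f x r :
  (1 <= n)%nat -> rank_ge n d f x n -> 0 < vnorm2 (S n) x ->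
  (forall z, orth (S n) z x -> vnorm (S n) z <= r * vnorm n (sderiv n d f x z)) ->
  opnorm_inv n d f x <= r.
Proof.
  intros Hn Hr Hx H.
  assert (Hd := rank_degrees_pos _ _ _ _ Hr).
  destruct (opnorm_inv_lub n d f x Hn Hr Hx) as [_ Hl]. apply Hl.
  intros t (w & z & Hw & Hz & HD & ->). eapply Rle_trans; [apply H; auto|].
  rewrite (vnorm_ext n _ w), Hw; [lra|].
  intros i Hi. unfold sderiv. rewrite HD by auto.
  pose proof (scale_pos n d x i (Hd i Hi) Hx).
  transitivity (Cmul (RtoC (/ scale n d x i * scale n d x i)) (w i)).
  - rewrite RtoC_mul; ring.
  - rewrite Rinv_l by lra. change (RtoC 1) with C1; ring.
Qed.

(** * Normalized systems and projective invariance *)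

Definition normalize (n : nat) (d : nat -> nat) (f : system) : system :=
  fun i al => Cmul (RtoC (/ normH n d f)) (f i al).

Lemma snonzero_normH n d f : snonzero n d f -> 0 < normH n d f.
Proof.
  intros (i & al & Hi & Hal & Hf). apply sqrt_lt_R0.
  eapply Rlt_le_trans.
  2: apply (Rsumn_ge_term n (fun i => pnorm2 n (d i) (f i)) i); auto;
     intros; apply pnorm2_ge0.
  unfold pnorm2. apply in_split in Hal. destruct Hal as (l1 & l2 & ->).
  rewrite Rsuml_app. simpl.
  assert (forall l, 0 <= Rsuml l (fun al => bw_weight al (d i) * Cnorm2 (f i al))).
  { intros l; apply Rsuml_ge0; intros b _.
    pose proof (bw_weight_pos b (d i)); pose proof (Cnorm2_ge0 (f i b)); nra. }
  pose proof (H l1); pose proof (H l2).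
  pose proof (Rmult_lt_0_compat _ _ (bw_weight_pos al (d i)) (Cnorm2_neq0 _ Hf)). lra.
Qed.

Lemma normH_normalize n d f : snonzero n d f -> normH n d (normalize n d f) = 1.
Proof.
  intros Hf; apply snonzero_normH in Hf.
  assert (E : normH n d (normalize n d f) * normH n d (normalize n d f) = 1).
  { rewrite normH_sq.
    transitivity (/ normH n d f * / normH n d f * (normH n d f * normH n d f)).
    - rewrite normH_sq, <- Rsumn_scal. apply Rsumn_ext; intros i _.
      unfold pnorm2. rewrite <- Rsuml_scal. apply Rsuml_ext; intros.
      unfold normalize. rewrite Cnorm2_mul, Cnorm2_RtoC. ring.
    - field; lra. }
  pose proof (normH_ge0 n d (normalize n d f)). nra.
Qed.

Lemma sderiv_normalize n d f x z i :
  sderiv n d (normalize n d f) x z i = Cmul (RtoC (/ normH n d f)) (sderiv n d f x z i).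
Proof.
  unfold sderiv.
  enough (Dfz n d (normalize n d f) x z i = Cmul (RtoC (/ normH n d f)) (Dfz n d f x z i))
    as -> by ring.
  unfold Dfz, normalize; rewrite <- Csuml_scal. apply Csuml_ext; intros; ring.
Qed.

Lemma sderiv_normdiff n d f g x z i :
  sderiv n d (normdiff n d f g) x z i
  = Csub (sderiv n d (normalize n d f) x z i) (sderiv n d (normalize n d g) x z i).
Proof.
  unfold sderiv.
  enough (Dfz n d (normdiff n d f g) x z i = Cadd (Dfz n d (normalize n d f) x z i)
    (Cmul (Copp C1) (Dfz n d (normalize n d g) x z i))) as -> by ring.
  unfold Dfz, normalize, normdiff; rewrite <- Csuml_scal, <- Csuml_add.
  apply Csuml_ext; intros; ring.
Qed.

Lemma normH_normdiff_sym n d f g : normH n d (normdiff n d g f) = normH n d (normdiff n d f g).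
Proof.
  unfold normH; f_equal. apply Rsumn_ext; intros; apply Rsuml_ext; intros.
  unfold normdiff, Cnorm2; simpl; ring.
Qed.

Lemma vnorm_sderiv_normalize n d f l x z :
  degrees_pos n d -> snonzero n d f -> 0 < vnorm2 (S n) x -> l <> C0 ->
  vnorm n (sderiv n d (normalize n d f) (fun k => Cmul l (x k)) z)
  = / normH n d f * vnorm n (sderiv n d f x z).
Proof.
  intros Hd Hf Hx Hl. apply snonzero_normH in Hf.
  rewrite (vnorm_ext _ _ (fun i => Cmul (RtoC (/ normH n d f))
    (sderiv n d f (fun k => Cmul l (x k)) z i))) by (intros; apply sderiv_normalize).
  rewrite vnorm_scal, vnorm_sderiv_homogeneous, Cabs_RtoC; auto.
  left; apply Rinv_0_lt_compat; auto.
Qed.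

Lemma orth_scal_iff m l z x : l <> C0 -> orth m z (fun k => Cmul l (x k)) <-> orth m z x.
Proof.
  intros Hl; split; [|apply orth_scal_r].
  unfold orth; rewrite herm_scal_r; intros H. apply Cmul_integral with (Cconj l); auto.
  intros E; apply Hl, Cnorm2_eq0. rewrite <- Cnorm2_conj, E; apply Cnorm2_C0.
Qed.

Section ConditionNumber.

Variables (n : nat) (d : nat -> nat) (f : system) (x : vec) (l : C).
Hypotheses (Hn : (1 <= n)%nat) (Hf : snonzero n d f) (Hx : 0 < vnorm2 (S n) x)
  (Hl : l <> C0) (Hr : rank_ge n d f x n).

Let x' : vec := fun k => Cmul l (x k).

(** mu is taken at the given [f] and [x], the bound at the normalized system and a rescaled point:
    mu depends only on the classes of [f] and [x] up to scaling. *)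
Lemma mu_bound z : orth (S n) z x' ->
  vnorm (S n) z <= mu n d f x * vnorm n (sderiv n d (normalize n d f) x' z).
Proof.
  intros Hz. unfold x'. rewrite vnorm_sderiv_normalize; auto.
  2: eapply rank_degrees_pos; eauto.
  apply orth_scal_iff in Hz; auto.
  pose proof (opnorm_inv_bound n d f x z Hn Hr Hx Hz). apply snonzero_normH in Hf.
  unfold mu. eapply Rle_trans; [eassumption|]. right; field; lra.
Qed.

Lemma mu_least r :
  (forall z, orth (S n) z x' ->
    vnorm (S n) z <= r * vnorm n (sderiv n d (normalize n d f) x' z)) ->
  mu n d f x <= r.
Proof.
  intros H. assert (HF := snonzero_normH _ _ _ Hf).
  unfold mu. apply Rmult_le_reg_l with (/ normH n d f); [apply Rinv_0_lt_compat; auto|].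
  rewrite <- Rmult_assoc, Rinv_l, Rmult_1_l by lra.
  apply opnorm_inv_least; auto. intros z Hz.
  apply (orth_scal_iff _ l) in Hz; auto. specialize (H z Hz). unfold x' in H.
  rewrite vnorm_sderiv_normalize in H; auto.
  2: eapply rank_degrees_pos; eauto. lra.
Qed.

(** For a normalized system at a unit point the scaled derivative does not increase norms, while |z|
    is at most mu times its norm; any [z] with nonzero image gives the claim. *)
Lemma mu_ge1 : vnorm2 (S n) x' = 1 -> 1 <= mu n d f x.
Proof.
  intros Hx1. assert (Hd := rank_degrees_pos _ _ _ _ Hr).
  destruct (inverse_values_nonempty n d f x Hn Hr Hx) as (t & w & z & Hw & Hz & HD & _).
  assert (Hz' : orth (S n) z x') by (apply orth_scal_iff; auto).
  pose proof (mu_bound z Hz') as H1.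
  pose proof (sderiv_bound_unit n d (normalize n d f) x' z Hd Hx1 Hz') as H2.
  rewrite normH_normalize, Rmult_1_l in H2 by auto.
  assert (HF := snonzero_normH _ _ _ Hf).
  assert (Hpos : 0 < vnorm n (sderiv n d (normalize n d f) x' z)).
  { unfold x'. rewrite vnorm_sderiv_normalize by auto.
    apply Rmult_lt_0_compat; [apply Rinv_0_lt_compat; auto|].
    rewrite (vnorm_ext n _ w), Hw; [lra|].
    intros i Hi. unfold sderiv. rewrite HD by auto.
    pose proof (scale_pos n d x i (Hd i Hi) Hx).
    transitivity (Cmul (RtoC (/ scale n d x i * scale n d x i)) (w i)).
    - rewrite RtoC_mul; ring.
    - rewrite Rinv_l by lra. change (RtoC 1) with C1; ring. }
  nra.
Qed.

End ConditionNumber.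

Lemma vnorm_le_sub m a b :
  vnorm m a <= vnorm m b + vnorm m (fun k => Csub (b k) (a k)).
Proof.
  rewrite (vnorm_ext m a (fun k => Cadd (b k) (Cmul (RtoC (-1)) (Csub (b k) (a k)))))
    by (intros; change (RtoC (-1)) with (mkC (-1) 0); C_solve).
  eapply Rle_trans; [apply vnorm_triangle|]. rewrite vnorm_scal.
  unfold Cabs; rewrite Cnorm2_RtoC.
  replace (-1 * -1) with 1 by ring. rewrite sqrt_1. right; f_equal. rewrite Rmult_1_l.
  apply vnorm_ext; intros; change (RtoC (-1)) with (mkC (-1) 0); C_solve.
Qed.

(** The intermediate stop is [f] at [y] along the projection [w]: from [f] at [x] only the point
    moves, and to [g] at [y] only the system changes, with |w| <= |z|. *)
Lemma sderiv_compare n d f g x y z c t :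
  degrees_pos n d -> snonzero n d f ->
  vnorm2 (S n) x = 1 -> vnorm2 (S n) y = 1 ->
  herm (S n) x y = RtoC c -> 0 <= c <= 1 -> 0 <= t -> 2 * (1 - c) <= t * t ->
  orth (S n) z x ->
  vnorm n (sderiv n d (normalize n d g) y (proj (S n) y z))
  <= vnorm n (sderiv n d (normalize n d f) x z)
     + (sqrt (3 * INR (Dmax n d)) * t + normH n d (normdiff n d f g)) * vnorm (S n) z.
Proof.
  intros Hd Hf Hx Hy Hc Hc01 Ht Hct Hz. set (w := proj (S n) y z).
  pose proof (sderiv_variation n d (normalize n d f) x y z c t Hd Hx Hy Hc Hc01 Ht Hct Hz) as H1.
  rewrite normH_normalize in H1 by auto. fold w in H1.
  pose proof (sderiv_bound_unit n d (normdiff n d f g) y w Hd Hy (proj_orth _ _ _ Hy)) as H2.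
  rewrite (vnorm_ext n _ _ (fun i _ => sderiv_normdiff n d f g y w i)) in H2.
  pose proof (vnorm_le_sub n (sderiv n d (normalize n d g) y w)
    (sderiv n d (normalize n d f) y w)) as H3.
  pose proof (vnorm_le_sub n (sderiv n d (normalize n d f) y w)
    (sderiv n d (normalize n d f) x z)) as H4.
  assert (Hwz : vnorm (S n) w <= vnorm (S n) z).
  { apply sqrt_le_1_alt. fold (vnorm2 (S n) w) (vnorm2 (S n) z).
    unfold w; rewrite vnorm2_proj by auto. pose proof (Cnorm2_ge0 (herm (S n) z y)); lra. }
  pose proof (normH_ge0 n d (normdiff n d f g)). nra.
Qed.

(** Projecting removes |<z, y>|^2 <= (1 - c^2) |z|^2 from |z|^2, leaving at least c^2 |z|^2. *)
Lemma vnorm_proj_ge m x y z c :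
  vnorm2 m x = 1 -> vnorm2 m y = 1 -> herm m x y = RtoC c -> 0 <= c -> orth m z x ->
  c * vnorm m z <= vnorm m (proj m y z).
Proof.
  intros Hx Hy Hc Hc0 Hz. apply Rsqr_incr_0_var; [|apply vnorm_ge0]. unfold Rsqr.
  rewrite vnorm_sq, vnorm2_proj by auto.
  pose proof (herm_orth_le m x y z c Hx Hy Hc Hz) as H. rewrite <- vnorm_sq in *. lra.
Qed.

Lemma one_minus_cos_le t : 0 <= t <= PI -> 2 * (1 - cos t) <= t * t.
Proof.
  intros Ht.
  replace (cos t) with (1 - 2 * sin (t / 2) * sin (t / 2)).
  2:{ rewrite <- cos_2a_sin. f_equal; field. }
  assert (0 <= sin (t / 2)) by (apply sin_ge_0; lra).
  assert (sin (t / 2) <= t / 2).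
  { destruct (proj1 Ht) as [h| <-]; [left; apply sin_lt_x; lra|].
    replace (0 / 2) with 0 by field. rewrite sin_0; lra. }
  nra.
Qed.

(** * Comparison of the condition numbers *)

Lemma not_rank_ge_S n d f x : ~ rank_ge n d f x (S n).
Proof.
  intros (zs & _ & Hind).
  destruct (linear_dependence n (fun l => Dfz n d f x (zs l))) as (c & (l & Hl & Hc) & H).
  apply Hc, (Hind c); auto.
Qed.

(** The witnesses at [y] are the projections of those at [x]. A relation among their images puts the
    projection of a combination [z] into the kernel of Dg(y); the two injectivity hypotheses give z
    = 0, and independence at [x] finishes. *)
Lemma rank_ge_perturb n d f g x y l :
  degrees_pos n d -> snonzero n d g -> 0 < vnorm2 (S n) y -> l <> C0 ->
  let y' := fun k => Cmul l (y k) in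
  vnorm2 (S n) y' = 1 ->
  rank_ge n d f x n ->
  (forall w, orth (S n) w y' ->
    vnorm n (sderiv n d (normalize n d g) y' w) = 0 -> vnorm (S n) w = 0) ->
  (forall z, orth (S n) z x -> vnorm (S n) (proj (S n) y' z) = 0 -> vnorm (S n) z = 0) ->
  rank_ge n d g y n.
Proof.
  intros Hd Hg Hy Hl y' Hy' (zs & Hzs & Hind) Hinj Hproj.
  assert (Horth : forall z, orth (S n) (proj (S n) y' z) y').
  { intros z; apply proj_orth; auto. }
  exists (fun k => proj (S n) y' (zs k)). split.
  { intros k _. apply (orth_scal_iff _ l); auto. }
  intros c Hc. apply Hind. intros i Hi.
  set (z := fun j => Csumn n (fun k => Cmul (c k) (zs k j))).
  assert (Hz : orth (S n) z x).
  { unfold orth, z; rewrite herm_Csumn_l. apply Csumn_eq0; intros k Hk.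
    rewrite (Hzs k Hk); ring. }
  assert (Hw : forall j, proj (S n) y' z j =
    Csumn n (fun k => Cmul (c k) (proj (S n) y' (zs k) j))).
  { intros j. unfold proj, z. rewrite herm_Csumn_l.
    transitivity (Cadd (Csumn n (fun k => Cmul (c k) (zs k j)))
      (Cmul (Copp (y' j)) (Csumn n (fun k => Cmul (c k) (herm (S n) (zs k) y'))))); [ring|].
    rewrite <- Csumn_scal, <- Csumn_add. apply Csumn_ext; intros; ring. }
  assert (H0 : vnorm (S n) z = 0).
  { apply Hproj; auto. apply Hinj; auto.
    unfold y' at 1. rewrite vnorm_sderiv_normalize by auto.
    rewrite (vnorm_ext n _ (fun k => Cmul C0 C0)).
    - rewrite vnorm_scal. unfold Cabs; rewrite Cnorm2_C0, sqrt_0; ring.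
    - intros k Hk. unfold sderiv.
      rewrite (Dfz_ext _ _ _ _ _ _ _ (fun j _ => Hw j)), Dfz_Csumn, Hc by auto. ring. }
  assert (Hz0 := vnorm2_eq0 _ _ (vnorm_eq0 _ _ H0)).
  rewrite <- Dfz_Csumn. fold z.
  rewrite (Dfz_ext n d f x z (fun k => Cmul C0 C0)) by (intros k Hk; rewrite (Hz0 k Hk); ring).
  rewrite Dfz_scal; ring.
Qed.

Lemma unit_representatives m x y :
  0 < vnorm2 m x -> 0 < vnorm2 m y ->
  let c := Cabs (herm m x y) / (vnorm m x * vnorm m y) in
  0 < c ->
  exists l l', l <> C0 /\ l' <> C0 /\
    vnorm2 m (fun k => Cmul l (x k)) = 1 /\ vnorm2 m (fun k => Cmul l' (y k)) = 1 /\
    herm m (fun k => Cmul l (x k)) (fun k => Cmul l' (y k)) = RtoC c.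
Proof.
  intros Hx Hy c Hc.
  assert (Nx := vnorm_pos m x Hx). assert (Ny := vnorm_pos m y Hy).
  set (h := herm m x y) in *.
  assert (Hh : 0 < Cabs h).
  { replace (Cabs h) with (c * (vnorm m x * vnorm m y)) by (unfold c; field; lra).
    apply Rmult_lt_0_compat; auto; nra. }
  assert (Hh2 : Cabs h * Cabs h = Cnorm2 h) by (apply sqrt_sqrt, Cnorm2_ge0).
  assert (Hhn : h <> C0).
  { intros E; rewrite E in Hh2; rewrite Cnorm2_C0 in Hh2. rewrite E in Hh. nra. }
  assert (U : forall r, 0 < r -> RtoC (/ r) <> C0).
  { intros r Hr; apply RtoC_neq0. apply Rinv_0_lt_compat in Hr; lra. }
  assert (Hny : 0 < vnorm m y * Cabs h) by nra.
  (* The phase of [h] is put on [y]: conjugation in the second slot turns the product into h conj h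
     / |h| = |h|, up to the norms. This requires [h] nonzero, hence 0 < c. *)
  exists (RtoC (/ vnorm m x)), (Cmul (RtoC (/ (vnorm m y * Cabs h))) h).
  split; [auto|]. split.
  { intros E; apply Hhn. apply Cmul_integral in E; auto. }
  split; [|split].
  - rewrite vnorm2_scal, Cnorm2_RtoC, <- vnorm_sq. field; lra.
  - rewrite vnorm2_scal, Cnorm2_mul, Cnorm2_RtoC, <- vnorm_sq, <- Hh2. field; lra.
  - rewrite herm_scal_l, herm_scal_r, Cconj_mul. fold h.
    transitivity (Cmul (RtoC (/ vnorm m x * / (vnorm m y * Cabs h))) (Cmul h (Cconj h))).
    + rewrite RtoC_mul. replace (Cconj (RtoC (/ (vnorm m y * Cabs h))))
        with (RtoC (/ (vnorm m y * Cabs h))) by C_solve. ring.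
    + rewrite Cmul_conj, <- RtoC_mul, <- Hh2. f_equal. unfold c. field; lra.
Qed.

Lemma herm_abs_ratio_bound m x y :
  0 < vnorm2 m x -> 0 < vnorm2 m y ->
  0 <= Cabs (herm m x y) / (vnorm m x * vnorm m y) <= 1.
Proof.
  intros Hx Hy.
  assert (Nx := vnorm_pos m x Hx). assert (Ny := vnorm_pos m y Hy).
  assert (Hp : 0 < vnorm m x * vnorm m y) by nra. split.
  - apply Rmult_le_pos; [apply sqrt_pos | left; apply Rinv_0_lt_compat; auto].
  - apply Rmult_le_reg_r with (vnorm m x * vnorm m y); auto.
    unfold Rdiv; rewrite Rmult_assoc, Rinv_l, Rmult_1_r, Rmult_1_l by lra.
    unfold vnorm. fold (vnorm2 m x) (vnorm2 m y).
    rewrite <- sqrt_mult by apply vnorm2_ge0. apply sqrt_le_1_alt, Cauchy_Schwarz.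
Qed.

(** All the real arithmetic of the theorem: [K] stands for mu(f, x), [e] for the distance of the
    normalized systems, [r] for the relative error. *)
Lemma slack_bounds D K t e c :
  2 <= D -> 1 <= K -> 0 <= t -> 0 <= e -> 0 <= c <= 1 -> 2 * (1 - c) <= t * t ->
  let u := D * sqrt D / 2 * K * t in
  let v := sqrt D * K * e in
  u <= 1/20 -> v <= 1/20 ->
  let r := K * (sqrt (3 * D) * t + e) in
  0 < c - r /\ 1 - 3805/1000 * u - v <= c - r /\ 1 + r <= (1 + 3504/1000 * u + v) * c.
Proof.
  intros HD HK Ht He Hc Hct u v Hu Hv r.
  assert (HS : 1 <= sqrt D) by (rewrite <- sqrt_1; apply sqrt_le_1_alt; lra).
  (* A rational upper bound for sqrt 3 = 1.73205... *)
  assert (H3 : sqrt 3 <= 1733/1000).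
  { rewrite <- (sqrt_square (1733/1000)) by lra. apply sqrt_le_1_alt; lra. }
  assert (E3 : sqrt (3 * D) = sqrt 3 * sqrt D) by (apply sqrt_mult; lra).
  assert (HKt : 0 <= K * t) by nra.
  assert (HSKt : K * t <= sqrt D * (K * t)) by nra.
  (* The only use of D >= 2 beyond D >= 1: the factor D / 2 in [u] is at least 1. *)
  assert (Hu1 : sqrt D * (K * t) <= u).
  { unfold u. replace (D * sqrt D / 2 * K * t) with ((D / 2) * (sqrt D * (K * t))) by field. nra. }
  assert (Ht1 : t <= u) by nra.
  assert (Hv1 : K * e <= v).
  { unfold v. replace (sqrt D * K * e) with (sqrt D * (K * e)) by ring.
    assert (0 <= K * e) by nra. nra. }
  assert (Hr : r <= 1733/1000 * u + v).
  { unfold r. rewrite E3.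
    replace (K * (sqrt 3 * sqrt D * t + e)) with (sqrt 3 * (sqrt D * (K * t)) + K * e) by ring.
    pose proof (sqrt_pos 3). nra. }
  (* From 1 - c <= t^2 / 2 with t <= u and t <= 1/20. *)
  assert (Hc1 : 1 - c <= u / 40) by nra.
  assert (0 <= K * e) by nra. assert (0 <= u) by lra. assert (0 <= v) by lra.
  clearbody u v r. repeat split; nra.
Qed.

Theorem theorem2 (n : nat) (d : nat -> nat) (f g : system) (x y : vec) :
  (2 <= n)%nat -> (2 <= Dmax n d)%nat ->
  snonzero n d f -> snonzero n d g ->
  vnonzero (S n) x -> vnonzero (S n) y ->
  rank_eq n d f x n ->
  let D := INR (Dmax n d) in
  let u := D * sqrt D / 2 * mu n d f x * dR (S n) x y in
  let v := sqrt D * mu n d f x * normH n d (normdiff n d f g) in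
  u <= 1/20 -> v <= 1/20 ->
  rank_eq n d g y n /\
  (1 - 3805/1000 * u - v) * mu n d g y <= mu n d f x /\
  mu n d f x <= (1 + 3504/1000 * u + v) * mu n d g y.
Proof.
  intros Hn HDmax Hf Hg Hx Hy [Hrf _] D u v Hu Hv.
  apply vnonzero_vnorm2 in Hx. apply vnonzero_vnorm2 in Hy.
  assert (Hd := rank_degrees_pos _ _ _ _ Hrf).
  assert (Hn1 : (1 <= n)%nat) by lia.
  assert (HD : 2 <= D) by (apply (le_INR 2); auto).
  set (c := Cabs (herm (S n) x y) / (vnorm (S n) x * vnorm (S n) y)).
  assert (Hc01 : 0 <= c <= 1) by (apply herm_abs_ratio_bound; auto).
  set (t := dR (S n) x y) in *.
  assert (Ht : 0 <= t <= PI) by apply acos_bound.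
  assert (Hct : 2 * (1 - c) <= t * t).
  { replace c with (cos t) by (apply cos_acos; fold c; lra). apply one_minus_cos_le; auto. }
  set (K := mu n d f x) in *.
  assert (HK : 1 <= K).
  { apply (mu_ge1 n d f x (RtoC (/ vnorm (S n) x))); auto.
    - apply RtoC_neq0. pose proof (Rinv_0_lt_compat _ (vnorm_pos _ _ Hx)). lra.
    - pose proof (vnorm_pos _ _ Hx).
      rewrite vnorm2_scal, Cnorm2_RtoC, <- vnorm_sq. field; lra. }
  set (e := normH n d (normdiff n d f g)) in *.
  assert (He : 0 <= e) by apply normH_ge0.
  destruct (slack_bounds D K t e c HD HK (proj1 Ht) He Hc01 Hct Hu Hv) as (Hpos & Hlow & Hupp).
  fold u in Hlow, Hupp. fold v in Hlow, Hupp.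
  set (delta := sqrt (3 * D) * t + e) in *.
  assert (Hdelta : 0 <= delta).
  { apply Rplus_le_le_0_compat; auto. apply Rmult_le_pos; [apply sqrt_pos | apply Ht]. }
  (* The smallness of [u] and [v] excludes orthogonal [x] and [y], so the phases can be aligned. *)
  assert (Hc0 : 0 < c) by nra.
  destruct (unit_representatives (S n) x y Hx Hy Hc0) as (l & l' & Hl & Hl' & Hx1 & Hy1 & Hxy).
  fold c in Hxy.
  set (x' := fun k => Cmul l (x k)) in *. set (y' := fun k => Cmul l' (y k)) in *.
  assert (Hyx : herm (S n) y' x' = RtoC c) by (rewrite herm_conj, Hxy; C_solve).
  set (al := fun z => vnorm n (sderiv n d (normalize n d f) x' z)).
  set (be := fun w => vnorm n (sderiv n d (normalize n d g) y' w)).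
  assert (Hfg : forall z, orth (S n) z x' ->
    be (proj (S n) y' z) <= al z + delta * vnorm (S n) z).
  { intros z Hz. apply (sderiv_compare n d f g x' y' z c t); auto; lra. }
  assert (Hgf : forall w, orth (S n) w y' ->
    al (proj (S n) x' w) <= be w + delta * vnorm (S n) w).
  { intros w Hw. unfold delta, e. rewrite <- normH_normdiff_sym.
    apply (sderiv_compare n d g f y' x' w c t); auto; lra. }
  assert (Hmuf : forall z, orth (S n) z x' -> vnorm (S n) z <= K * al z).
  { intros z Hz; apply (mu_bound n d f x l); auto. }
  (* Chain: c |w| is at most the norm of the projection of [w], which is at most [K * al] of it,
     hence at most [K * (be w + delta * |w|)]. As c - K delta > 0, this makes Dg(y) injective on the
     complement of [y]. *)
  assert (Hg_low : forall w, orth (S n) w y' -> (c - K * delta) * vnorm (S n) w <= K * be w).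
  { intros w Hw. pose proof (Hgf w Hw) as H1.
    pose proof (vnorm_proj_ge (S n) y' x' w c Hy1 Hx1 Hyx (Rlt_le _ _ Hc0) Hw) as H2.
    pose proof (Hmuf _ (proj_orth (S n) x' w Hx1)) as H3. nra. }
  assert (Hrg : rank_ge n d g y n).
  { apply (rank_ge_perturb n d f g x y l'); auto.
    - intros w Hw H0. pose proof (Hg_low w Hw) as H1. unfold be in H1. fold y' in H0.
      rewrite H0 in H1. pose proof (vnorm_ge0 (S n) w). nra.
    - intros z Hz H0. fold y' in H0. apply (orth_scal_r _ _ l) in Hz. fold x' in Hz.
      pose proof (vnorm_proj_ge (S n) x' y' z c Hx1 Hy1 Hxy (Rlt_le _ _ Hc0) Hz) as H1.
      rewrite H0 in H1. pose proof (vnorm_ge0 (S n) z). nra. }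
  split; [split; [auto | apply not_rank_ge_S]|].
  set (K' := mu n d g y).
  assert (HK' : 1 <= K') by (apply (mu_ge1 n d g y l'); auto).
  split.
  - assert (H : K' <= K / (c - K * delta)).
    { apply (mu_least n d g y l'); auto. intros w Hw. fold y' in Hw |- *. fold (be w).
      apply Rmult_le_reg_l with (c - K * delta); auto.
      replace ((c - K * delta) * (K / (c - K * delta) * be w)) with (K * be w) by (field; lra).
      auto. }
    apply Rle_trans with ((c - K * delta) * K').
    + apply Rmult_le_compat_r; lra.
    + apply Rmult_le_reg_l with (/ (c - K * delta)); [apply Rinv_0_lt_compat; auto|].
      rewrite <- Rmult_assoc, Rinv_l by lra. lra.
  - assert (H : K <= K' * (1 + K * delta) / c).
    { apply (mu_least n d f x l); auto. intros z Hz. fold x' in Hz |- *. fold (al z).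
      apply Rmult_le_reg_l with c; auto.
      replace (c * (K' * (1 + K * delta) / c * al z)) with (K' * (al z + delta * (K * al z)))
        by (field; lra).
      pose proof (vnorm_proj_ge (S n) x' y' z c Hx1 Hy1 Hxy (Rlt_le _ _ Hc0) Hz) as H1.
      assert (H2 : vnorm (S n) (proj (S n) y' z) <= K' * be (proj (S n) y' z)).
      { apply (mu_bound n d g y l'); auto. apply (proj_orth _ _ _ Hy1). }
      pose proof (Hfg z Hz) as H3. pose proof (Hmuf z Hz) as H4.
      assert (H5 : delta * vnorm (S n) z <= delta * (K * al z))
        by (apply Rmult_le_compat_l; auto).
      assert (H6 : K' * be (proj (S n) y' z) <= K' * (al z + delta * (K * al z)))
        by (apply Rmult_le_compat_l; lra).
      lra. }
    eapply Rle_trans; [exact H|].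
    apply Rmult_le_reg_r with c; auto.
    replace (K' * (1 + K * delta) / c * c) with (K' * (1 + K * delta)) by (field; lra).
    replace ((1 + 3504 / 1000 * u + v) * K' * c)
      with (K' * ((1 + 3504 / 1000 * u + v) * c)) by ring.
    apply Rmult_le_compat_l; lra.
Qed.
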